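(* Let $P$ be a two-dimensional reflexive polytope with respect to a lattice $M\cong\mathbb Z^2$. 1. $P$ has at most six vertices; equality occurs if and only if $P$ is isomorphic, as a lattice polytope, to the hexagon $\mathrm{conv}(\pm[0,1]^2)$ (with respect to $\mathbb Z^2$). 2. Any facet (edge) of $P$ contains at most five lattice points; there exists a facet with five lattice points if and only if $P$ is isomorphic, as a lattice polytope, to the triangle $\mathrm{conv}\big((-1,1),(1,1),(1,-3)\big)$ (with respect to $\mathbb Z^2$).
   Context: A reflexive polytope is a full-dimensional lattice polytope $P\subseteq M_{\mathbb R}$ with $0\in\mathrm{int}\,P$ such that the dual $P^*=\{y\in N_{\mathbb R}:\langle x,y\rangle\ge -1\ \forall x\in P\}$ is a lattice polytope with respect to the dual lattice $N$ of $M$. An isomorphism of lattice polytopes is an isomorphism of the lattices whose real linear extension maps one polytope onto the other. $\pm[0,1]^2$ means $[0,1]^2\cup(-[0,1]^2)$. *)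

(* Defs.v *)
From HB Require Import structures.
From mathcomp Require Import all_boot all_order all_algebra.
From mathcomp Require Import all_classical all_reals all_analysis.

Set Implicit Arguments.
Unset Strict Implicit.
Unset Printing Implicit Defensive.

Import Order.TTheory GRing.Theory Num.Theory.
Import numFieldNormedType.Exports.

Local Open Scope classical_set_scope.
Local Open Scope ring_scope.

(* The ambient space M_R is R^n (row vectors) and the lattice M is an arbitrary
   full-rank lattice in it; N_R is identified with R^n by the standard pairing,
   so that the dual lattice N is [dual_lattice M]. *)

Section LatticePolytopes.
Context {R : realType}.

Definition pairing n (x y : 'rV[R]_n) : R := (x *m y^T) 0 0.

Definition lattice_of_basis n (B : 'M[R]_n) : set 'rV[R]_n :=
  [set map_mx intr z *m B | z in [set: 'rV[int]_n]].

Definition is_lattice n (M : set 'rV[R]_n) : Prop :=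
  exists2 B : 'M[R]_n, B \in unitmx & M = lattice_of_basis B.

Definition standard_lattice n : set 'rV[R]_n := lattice_of_basis 1%:M.

Definition dual_lattice n (M : set 'rV[R]_n) : set 'rV[R]_n :=
  [set y | forall x, M x -> pairing x y \is a Num.int].

Definition conv_hull n (A : set 'rV[R]_n) : set 'rV[R]_n :=
  smallest (@convex_set R 'rV[R]_n) A.

Definition affine_hull n (A : set 'rV[R]_n) : set 'rV[R]_n :=
  [set x | exists k (c : 'I_k -> R) (p : 'I_k -> 'rV[R]_n),
     [/\ \sum_(i < k) c i = 1, forall i, A (p i) & x = \sum_(i < k) c i *: p i]].

(* The dimension of a set is that of its affine hull; the empty set has none. *)
Definition has_dim n (A : set 'rV[R]_n) (d : nat) : Prop :=
  exists x0 : 'rV[R]_n, exists2 U : 'M[R]_n,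
    \rank U = d & affine_hull A = [set x0 + u | u in [set u | (u <= U)%MS]].

Definition lattice_polytope n (M P : set 'rV[R]_n) : Prop :=
  exists S : set 'rV[R]_n, [/\ finite_set S, S `<=` M & P = conv_hull S].

Definition polar_dual n (P : set 'rV[R]_n) : set 'rV[R]_n :=
  [set y | forall x, P x -> -1 <= pairing x y].

Definition reflexive_polytope n (M P : set 'rV[R]_n) : Prop :=
  [/\ lattice_polytope M P, has_dim P n, P° 0
    & lattice_polytope (dual_lattice M) (polar_dual P)].

(* Taking u = 0, the polytope itself is a face, and so is the empty set. *)
Definition face n (P F : set 'rV[R]_n) : Prop :=
  exists (u : 'rV[R]_n) (c : R),
    (forall x, P x -> c <= pairing x u) /\
    F = P `&` [set x | pairing x u = c].

Definition vertices n (P : set 'rV[R]_n) : set 'rV[R]_n :=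
  [set v | face P [set v]].

Definition facet n (P F : set 'rV[R]_n) : Prop := face P F /\ has_dim F n.-1.

(* A linear map restricting to a bijection M -> M' is the real extension of an
   isomorphism of lattices, since M spans the ambient space. *)
Definition lattice_polytope_iso m n (M P : set 'rV[R]_m)
    (M' P' : set 'rV[R]_n) : Prop :=
  exists f : {linear 'rV[R]_m -> 'rV[R]_n}, set_bij M M' f /\ f @` P = P'.

Definition point2 (a b : R) : 'rV[R]_2 := \row_(j < 2) [:: a; b]`_j.

Definition unit_square : set 'rV[R]_2 :=
  [set x | forall j : 'I_2, 0 <= x 0 j <= 1].

Definition hexagon : set 'rV[R]_2 :=
  conv_hull (unit_square `|` [set - x | x in unit_square]).

Definition triangle : set 'rV[R]_2 :=
  conv_hull [set point2 (-1) 1; point2 1 1; point2 1 (-3)].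

End LatticePolytopes.

Arguments standard_lattice {R} n.
Arguments hexagon R : clear implicits.
Arguments triangle R : clear implicits.

(* Main.v *)
Require Import Defs.
From mathcomp Require Import all_boot all_order all_algebra finmap.
From mathcomp Require Import all_classical all_reals all_analysis.
From mathcomp Require Import ring lra zify.

Import Order.TTheory GRing.Theory Num.Theory.
Import numFieldNormedType.Exports.

Local Open Scope classical_set_scope.
Local Open Scope card_scope.
Local Open Scope ring_scope.

Set Implicit Arguments.
Unset Strict Implicit.
Unset Printing Implicit Defensive.

(** Everything rests on two finite sets: lattice points whose convex hull is
    [P], and dual lattice points whose convex hull is the polar dual. Since [0]
    is interior to [P] and [P] is bounded, every nonzero [w] is positive on
    some lattice point of [P] ([reflexive_gt0]) and negative against some dual
    lattice point [t] of the polar dual ([reflexive_dual_lt0]). As such a [t]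
    is at least [-1] on [P] and integral on [M], a nonzero lattice point of [P]
    has height exactly [-1] under some [t] ([reflexive_height1]). So if [v] is
    a primitive vector at level [<., t> = 0], the slice of [P] at this level
    lies in the segment from [-v] to [v] ([frame_slice]).

    Vertices. Let [w] be the sum of all [n] vertices and take [t != 0] with
    [<w, t> <= 0]. The integers [<x, t>], for [x] a vertex, are at least [-1]
    and have sum at most [0], while a line contains at most two vertices.
    Hence levels [-1] and [0] carry at most two vertices each, the positive
    levels together outweigh at most those at level [-1], and [n <= 6]
    ([vertex_levels]). If [n = 6], the levels are [-1, -1, 0, 0, 1, 1]; the
    vertices at level [0] are [v] and [-v], and the midpoints of the points at
    levels [-1] and [1] lie in the slice, which leaves one configuration up to
    a change of basis ([six_vertices_frame]). No other lattice point of [P] can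
    lie beyond an edge of this hexagon ([adjacent_vertices_le]), so [P] is the
    hexagon.

    Facets. The normal of a facet, scaled to height [-1], is a dual lattice
    point [t] ([facet_height]). Suppose that the facet contains lattice points
    [p] and [p + n v], and let [s] be a lattice point of [P] at level [h >= 1].
    The triangle they span meets level [0] in a segment of length
    [n h / (h + 1)] in units of [v], which is at most [2]; hence
    [n <= 2 + 2 / h <= 4] ([facet_diameter]). For [n = 4] this forces [h = 1]
    and determines [s], so [P] is the triangle
    ([wide_facet_iso_triangle]). *)

(** * The standard pairing *)

Section Pairing.
Context {R : realType} {n : nat}.
Implicit Types (x y z u : 'rV[R]_n) (a : R).

Lemma pairingE x y : pairing x y = \sum_i x 0 i * y 0 i.
Proof. by rewrite /pairing mxE; apply: eq_bigr => i _; rewrite mxE. Qed.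

Lemma pairingC x y : pairing x y = pairing y x.
Proof. by rewrite !pairingE; apply: eq_bigr => i _; rewrite mulrC. Qed.

Lemma pairingDl x y u : pairing (x + y) u = pairing x u + pairing y u.
Proof. by rewrite /pairing mulmxDl mxE. Qed.

Lemma pairingZl a x u : pairing (a *: x) u = a * pairing x u.
Proof. by rewrite /pairing -scalemxAl mxE. Qed.

Lemma pairingNl x u : pairing (- x) u = - pairing x u.
Proof. by rewrite -scaleN1r pairingZl mulN1r. Qed.

Lemma pairing0l u : pairing 0 u = 0.
Proof. by rewrite -(scale0r 0) pairingZl mul0r. Qed.

Lemma pairing_suml (I : Type) (r : seq I) (F : I -> 'rV[R]_n) u :
  pairing (\sum_(i <- r) F i) u = \sum_(i <- r) pairing (F i) u.
Proof.
apply: (big_morph (fun x => pairing x u)); last exact: pairing0l.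
by move=> x y; rewrite pairingDl.
Qed.

Lemma pairingDr x y u : pairing u (x + y) = pairing u x + pairing u y.
Proof. by rewrite !(pairingC u) pairingDl. Qed.

Lemma pairingZr a x u : pairing u (a *: x) = a * pairing u x.
Proof. by rewrite !(pairingC u) pairingZl. Qed.

Lemma pairingNr x u : pairing u (- x) = - pairing u x.
Proof. by rewrite !(pairingC u) pairingNl. Qed.

Lemma pairing0r u : pairing u 0 = 0.
Proof. by rewrite pairingC pairing0l. Qed.

Lemma pairing_mul m x (A : 'M[R]_(n, m)) (y : 'rV[R]_m) :
  pairing (x *m A) y = pairing x (y *m A^T).
Proof. by rewrite /pairing trmx_mul trmxK mulmxA. Qed.

Lemma pairing_gt0 x : x != 0 -> 0 < pairing x x.
Proof.
move=> x0; rewrite lt0r pairingE; apply/andP; split; last first.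
  by apply: sumr_ge0 => i _; rewrite -expr2 sqr_ge0.
apply: contra x0; rewrite psumr_eq0 => [/allP h|i _]; last first.
  by rewrite -expr2 sqr_ge0.
apply/eqP/rowP => i; rewrite mxE; apply/eqP.
by have := h i (mem_index_enum i); rewrite /= mulf_eq0 orbb.
Qed.

End Pairing.

Definition pairingP := (@pairingDl, @pairingDr, @pairingNl, @pairingNr,
  @pairingZl, @pairingZr, @pairing0l, @pairing0r).

(** * Convex hulls *)

Section Convexity.
Context {R : realType} {n : nat}.
Implicit Types (x y z u : 'rV[R]_n) (a b c : R) (A C : set 'rV[R]_n).

Lemma convex_setP C : @convex_set R 'rV[R]_n C <->
  forall x y a b, 0 <= a -> 0 <= b -> a + b = 1 -> C x -> C y ->
    C (a *: x + b *: y).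
Proof.
split=> [cC x y a b a0 b0 ab Cx Cy|cC x y l].
  have a1 : a <= 1 by lra.
  have abi : Itv.spec (@Itv.num_sem R) (Itv.Real `[0%Z, 1%Z]) a.
    by rewrite /= /Itv.num_sem /= realE a0 /= in_itv /= a0 a1.
  have := cC x y (Itv.Def abi); rewrite !inE => /(_ Cx Cy).
  by rewrite /conv /= (_ : b = 1 - a) //; lra.
rewrite !inE => Cx Cy; apply: cC => //; rewrite ?subr_ge0//.
by rewrite addrC subrK.
Qed.

Lemma conv_hull_convex A : @convex_set R 'rV[R]_n (conv_hull A).
Proof.
apply/convex_setP => x y a b a0 b0 ab Ax Ay C [cC AC].
by move/convex_setP: (cC); apply => //; [exact: Ax|exact: Ay].
Qed.

Lemma conv_hull2 A x y a b : 0 <= a -> 0 <= b -> a + b = 1 ->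
  conv_hull A x -> conv_hull A y -> conv_hull A (a *: x + b *: y).
Proof. exact: (iffLR (convex_setP _) (@conv_hull_convex A)). Qed.

Lemma sub_conv_hull A : A `<=` conv_hull A.
Proof. exact: sub_gen_smallest. Qed.

Lemma conv_hull_sub A C : @convex_set R 'rV[R]_n C -> A `<=` C ->
  conv_hull A `<=` C.
Proof. exact: smallest_sub. Qed.

Lemma conv_hull_ge A u c : (forall x, A x -> c <= pairing x u) ->
  forall x, conv_hull A x -> c <= pairing x u.
Proof.
move=> Ac; apply: conv_hull_sub => //=; apply/convex_setP => x y a b a0 b0 ab.
rewrite /= !pairingP => cx cy; rewrite -[c]mul1r -ab mulrDl.
by rewrite lerD// ler_wpM2l.
Qed.

Lemma conv_hull_gt A u c : (forall x, A x -> c < pairing x u) ->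
  forall x, conv_hull A x -> c < pairing x u.
Proof.
move=> Ac; apply: conv_hull_sub => //=; apply/convex_setP => x y a b a0 b0 ab.
rewrite /= !pairingP => cx cy; rewrite -[c]mul1r -ab mulrDl.
move: a0; rewrite le_eqVlt => /predU1P[a0|a0].
  by rewrite -a0 !mul0r !add0r ltr_pM2l//; lra.
by rewrite ltr_leD// ?ltr_pM2l// ler_wpM2l// ltW.
Qed.

Lemma conv_hull_le A u c : (forall x, A x -> pairing x u <= c) ->
  forall x, conv_hull A x -> pairing x u <= c.
Proof.
move=> Ac x Ax; rewrite -lerN2 -pairingNr.
by apply: conv_hull_ge Ax => y /Ac; rewrite pairingNr lerN2.
Qed.

Lemma finite_set_pairing_bounded A u : finite_set A ->
  exists2 c, 0 < c & forall x, A x -> pairing x u <= c.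
Proof.
move=> /finite_seqP[s ->]; exists (1 + \sum_(x <- s) `|pairing x u|).
  by rewrite ltr_pwDl// sumr_ge0.
move=> x /= xs; rewrite (big_rem x)//= addrCA.
apply: (le_trans (ler_norm _)); rewrite lerDl addr_ge0//.
by rewrite sumr_ge0.
Qed.

Lemma interior0_scale A u : A° 0 -> exists2 e, 0 < e & A (e *: u).
Proof.
move=> A0; have : \forall k \near (0 : R), A (k *: u).
  have /= := @scalel_continuous R 'rV[R]_n u 0 A; rewrite scale0r; apply.
  exact: A0.
rewrite -nbhs_nearE => /nbhs_ballP[e /= e0 eA]; exists (e / 2); first lra.
by apply: eA; rewrite /ball /= sub0r normrN gtr0_norm; lra.
Qed.

Lemma conv_hull3 A x y z a b c : conv_hull A x ->
  conv_hull A y -> conv_hull A z -> 0 <= a -> 0 <= b -> 0 <= c ->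
  a + b + c = 1 -> conv_hull A (a *: x + b *: y + c *: z).
Proof.
move=> Ax Ay Az a0 b0 c0 abc.
have [ab0|ab0] := eqVneq (a + b) 0.
  have [-> [-> ->]] : a = 0 /\ b = 0 /\ c = 1 by lra.
  by rewrite !scale0r !add0r scale1r.
have abi : (a + b) * (a + b)^-1 = 1 by rewrite divff.
have abi0 : 0 <= (a + b)^-1 by rewrite invr_ge0 addr_ge0.
have -> : a *: x + b *: y + c *: z =
    (a + b) *: ((a / (a + b)) *: x + (b / (a + b)) *: y) + c *: z.
  rewrite scalerDr !scalerA.
  by congr (_ *: _ + _ *: _ + _); rewrite mulrCA abi mulr1.
apply: conv_hull2; [exact: addr_ge0|by []|by []| |by []].
by apply: conv_hull2; rewrite ?mulr_ge0// -mulrDl abi.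
Qed.

Lemma conv_hull_cone A x y a b : conv_hull A 0 ->
  conv_hull A x -> conv_hull A y -> 0 <= a -> 0 <= b -> a + b <= 1 ->
  conv_hull A (a *: x + b *: y).
Proof.
move=> A0 Ax Ay a0 b0 ab; rewrite -[_ + _]addr0 -(scaler0 _ (1 - (a + b))).
by apply: conv_hull3 => //; lra.
Qed.

End Convexity.

(** * Lattice polytopes and reflexivity *)

Section Polytope.
Context {R : realType} {n : nat}.
Implicit Types (x y z u v w : 'rV[R]_n) (a b c : R) (M P C : set 'rV[R]_n).

Lemma polytope_conv M P x y a b : lattice_polytope M P ->
  0 <= a -> 0 <= b -> a + b = 1 -> P x -> P y -> P (a *: x + b *: y).
Proof. by move=> [S [_ _ ->]]; exact: conv_hull2. Qed.

Lemma polytope_midpoint M P x y : lattice_polytope M P ->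
  P x -> P y -> P (2^-1 *: (x + y)).
Proof.
by move=> hP Px Py; rewrite scalerDr; apply: (polytope_conv hP) => //; lra.
Qed.

(** The points of the lattice in [P] are a canonical choice of generators, so
    containments of [P] in convex sets can be tested on them. *)
Lemma polytope_hull M P : lattice_polytope M P -> P = conv_hull (M `&` P).
Proof.
move=> hP; have [S [_ SM PS]] := hP; apply/seteqP; split.
  rewrite {1}PS; apply: conv_hull_sub; first exact: conv_hull_convex.
  move=> s Ss; apply: sub_conv_hull; split; first exact: SM.
  by rewrite PS; exact: sub_conv_hull.
apply: conv_hull_sub => [|x []//].
by rewrite PS; exact: conv_hull_convex.
Qed.

Lemma polytope_bounded M P u : lattice_polytope M P ->
  exists2 c, 0 < c & forall x, P x -> pairing x u <= c.
Proof.
move=> [S [Sfin _ ->]]; have [c c0 Sc] := finite_set_pairing_bounded u Sfin.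
by exists c => //; exact: conv_hull_le.
Qed.

Lemma vertexP P v : vertices P v <->
  P v /\ exists u, forall x, P x -> x != v -> pairing v u < pairing x u.
Proof.
split=> [[u [c [Pc /seteqP[vP Pv]]]]|[Pv [u Pu]]].
  have [Pv0 /= vc] := vP v erefl; split=> //; exists u => x Px xv.
  rewrite vc lt_neqAle Pc// andbT; apply: contra xv => /eqP xc.
  by apply/eqP; exact: Pv.
exists u, (pairing v u); split=> [x Px|].
  by have [->//|xv] := eqVneq x v; apply/ltW/Pu.
apply/seteqP; split=> [_ -> //|x [Px /= xv]]; apply/eqP; apply: contraPT xv => xv.
by have := Pu x Px xv; rewrite lt_neqAle => /andP[/eqP + _] => /nesym.
Qed.

(** A strict minimiser of a linear functional is not a proper convex
    combination of points with larger values. *)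
Lemma vertex_extreme P v x y a b : vertices P v -> P x -> P y ->
  0 < a -> 0 < b -> a + b = 1 -> v = a *: x + b *: y -> x = v.
Proof.
move=> /vertexP[Pv [u Pu]] Px Py a0 b0 ab vE; apply/eqP; apply/negP => /negP xv.
have ux := Pu x Px xv; have uy : pairing v u <= pairing y u.
  by have [->//|yv] := eqVneq y v; apply/ltW/Pu.
have : pairing v u = a * pairing x u + b * pairing y u by rewrite {1}vE !pairingP.
have -> : b = 1 - a by lra.
nra.
Qed.

Lemma vertex_gen A v : vertices (conv_hull A) v -> A v.
Proof.
move=> /vertexP[Av [u Au]]; apply: contrapT => nAv.
suff : pairing v u < pairing v u by rewrite ltxx.
apply: conv_hull_gt Av => x Ax; apply: Au; first exact: sub_conv_hull.
by apply/eqP => xv; rewrite xv in Ax.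
Qed.

Lemma vertex_lattice M P : lattice_polytope M P -> vertices P `<=` M.
Proof. by move=> [S [_ SM ->]] v /vertex_gen; exact: SM. Qed.

Lemma finite_vertices M P : lattice_polytope M P -> finite_set (vertices P).
Proof.
move=> [S [Sfin _ ->]]; apply: sub_finite_set Sfin; exact: vertex_gen.
Qed.

(** A functional exposing a vertex of the image pulls back along the transpose
    of [A], and injectivity keeps the minimiser unique. *)
Lemma vertices_image P (f : {linear 'rV[R]_n -> 'rV[R]_n}) (A : 'M[R]_n) :
  (forall x, f x = x *m A) -> A \in unitmx ->
  vertices (f @` P) `<=` f @` vertices P.
Proof.
move=> fE Au _ /vertexP[[v Pv <-] [u fu]]; exists v => //; apply/vertexP.
split=> //; exists (u *m A^T) => x Px xv; rewrite -!pairing_mul -!fE.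
apply: fu; first by exists x.
apply: contra xv => /eqP; rewrite !fE => /(congr1 (mulmx^~ (invmx A))).
by rewrite !mulmxK// => ->.
Qed.

Section Reflexive.
Context (M P : set 'rV[R]_n) (hP : reflexive_polytope M P).

Lemma reflexive_polytopeW : lattice_polytope M P. Proof. by case: hP. Qed.

Lemma reflexive_scale w : exists2 e, 0 < e & P (e *: w).
Proof. by case: hP => _ _ P0 _; exact: interior0_scale. Qed.

Lemma reflexive0 : P 0.
Proof. by have [e _] := reflexive_scale 0; rewrite scaler0. Qed.

(** A small positive multiple of [w] lies in [P], and [w] is positive on it;
    were [w] nonpositive on the lattice points of [P], it would be so on their
    convex hull. *)
Lemma reflexive_gt0 w : w != 0 -> exists s, [/\ M s, P s & 0 < pairing s w].
Proof.
move=> w0; apply: contrapT => noS.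
have [e e0 Pe] := reflexive_scale w.
suff : pairing (e *: w) w <= 0.
  by rewrite pairingP leNgt mulr_gt0// pairing_gt0.
move: Pe; rewrite {1}(polytope_hull reflexive_polytopeW).
apply: conv_hull_le => s [Ms Ps]; rewrite leNgt; apply/negP => sw.
by apply: noS; exists s.
Qed.

(** Boundedness of [P] puts a small multiple of [-w] into the polar dual, which
    is the convex hull of its dual lattice points. *)
Lemma reflexive_dual_lt0 w : w != 0 ->
  exists t, [/\ dual_lattice M t, polar_dual P t & pairing w t < 0].
Proof.
move=> w0; apply: contrapT => noT.
have [c c0 Pc] := polytope_bounded w reflexive_polytopeW.
have Pw : polar_dual P (- c^-1 *: w).
  by move=> x /Pc; rewrite !pairingP mulNr lerN2 mulrC ler_pdivrMr// mul1r.
have [_ _ _ hD] := hP.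
suff : 0 <= pairing (- c^-1 *: w) w.
  by rewrite !pairingP mulNr oppr_ge0 leNgt mulr_gt0// ?invr_gt0// pairing_gt0.
move: Pw; rewrite {1}(polytope_hull hD); apply: conv_hull_ge => t [Nt Pt].
rewrite pairingC leNgt; apply/negP => wt; apply: noT; by exists t.
Qed.

(** The only negative integer that is at least [-1]. In particular [0] is the
    only lattice point in the interior of [P]. *)
Lemma reflexive_height1 x : M x -> P x -> x != 0 ->
  exists t, [/\ dual_lattice M t, polar_dual P t & pairing x t = -1].
Proof.
move=> Mx Px /reflexive_dual_lt0[t [Nt Pt xt]]; exists t; split=> //.
have := Pt x Px; have /intrP[k kE] := Nt x Mx; move: xt; rewrite kE => k0 k1.
have {}k0 : k < 0 by rewrite -(ltrz0 R).
have {}k1 : -1 <= k by rewrite -(ler_int R) (le_trans _ k1).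
by rewrite (_ : k = -1)//; lia.
Qed.

(** A functional exposing [0] is nonnegative on [P], although [0] is an interior
    point. *)
Lemma vertex_neq0 v : (0 < n)%N -> vertices P v -> v != 0.
Proof.
move=> n0 /vertexP[_ [u Pu]]; apply/eqP => v0.
case: (eqVneq u 0) => [u0|uN0].
  have [e e0 Pe] := reflexive_scale (delta_mx 0 (Ordinal n0)).
  have := Pu _ Pe; rewrite u0 v0 !pairingP ltxx.
  suff : e *: delta_mx 0 (Ordinal n0) != 0 :> 'rV[R]_n by move=> -> /(_ isT).
  apply/eqP => /rowP/(_ (Ordinal n0)); rewrite !mxE !eqxx mulr1 => e00.
  by rewrite e00 ltxx in e0.
have [s [_ Ps]] := @reflexive_gt0 (- u) ltac:(by rewrite oppr_eq0).
rewrite pairingP oppr_gt0 => su.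
have s0 : s != v by apply: contraTneq su => ->; rewrite v0 pairingP ltxx.
by have := Pu s Ps s0; rewrite v0 pairingP; lra.
Qed.

End Reflexive.

End Polytope.

(** * Plane coordinates and integral reals *)

Section Plane.
Context {R : realType}.
Implicit Types x y u t : 'rV[R]_2.

Lemma pairing2E x y : pairing x y = x 0 0 * y 0 0 + x 0 1 * y 0 1.
Proof.
rewrite pairingE big_ord_recl big_ord1.
by rewrite (_ : lift ord0 ord0 = 1)//; exact/val_inj.
Qed.

Lemma row2P x y : x 0 0 = y 0 0 -> x 0 1 = y 0 1 -> x = y.
Proof.
move=> xy0 xy1; apply/rowP => -[[|[|//]] hi].
  by rewrite (_ : Ordinal hi = 0)//; exact/val_inj.
by rewrite (_ : Ordinal hi = 1)//; exact/val_inj.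
Qed.

Definition orthogonal_row u : 'rV[R]_2 := point2 (- u 0 1) (u 0 0).

Lemma pairing_orthogonal_row x u :
  pairing x (orthogonal_row u) = x 0 1 * u 0 0 - x 0 0 * u 0 1.
Proof. by rewrite pairing2E !mxE /=; ring. Qed.

(** The rows [u] and [orthogonal_row u] form an orthogonal basis. *)
Lemma orthogonal_row_inj u x y : u != 0 -> pairing x u = pairing y u ->
  pairing x (orthogonal_row u) = pairing y (orthogonal_row u) -> x = y.
Proof.
move=> u0; have := pairing_gt0 u0; set c := pairing u u => c0 xyu xyo.
have cE : c = u 0 0 ^+ 2 + u 0 1 ^+ 2 by rewrite /c pairing2E; ring.
move: xyu xyo; rewrite !pairing_orthogonal_row !pairing2E => xyu xyo.
have c_neq0 : c != 0 by rewrite gt_eqF.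
apply: row2P; apply: (mulIf c_neq0); rewrite cE.
  transitivity (u 0 0 * (x 0 0 * u 0 0 + x 0 1 * u 0 1)
    - u 0 1 * (x 0 1 * u 0 0 - x 0 0 * u 0 1)); first by ring.
  by rewrite xyu xyo; ring.
transitivity (u 0 1 * (x 0 0 * u 0 0 + x 0 1 * u 0 1)
  + u 0 0 * (x 0 1 * u 0 0 - x 0 0 * u 0 1)); first by ring.
by rewrite xyu xyo; ring.
Qed.

Lemma pairing_point2 (a b c d : R) :
  pairing (point2 a b) (point2 c d) = a * c + b * d.
Proof. by rewrite pairing2E !mxE. Qed.

Lemma point2_eta (x : 'rV[R]_2) : x = point2 (x 0 0) (x 0 1).
Proof. by apply: row2P; rewrite !mxE. Qed.

End Plane.

Lemma int_lt2_le1 (R : realType) (a : R) : a \is a Num.int -> a < 2 -> a <= 1.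
Proof.
move=> /intrP[k ->] k2; have : k < 2 by rewrite -(ltr_int R).
by rewrite lerz1; lia.
Qed.

Lemma int_gt0_ge1 (R : realType) (a : R) : a \is a Num.int -> 0 < a -> 1 <= a.
Proof.
by move=> /intrP[k ->]; rewrite ltr0z -[1]/(1%:~R) ler_int.
Qed.

(** * Lattice frames of the plane *)

Section LatticeFrames.
Context {R : realType}.

Lemma lattice_comb n (M : set 'rV[R]_n) x y a b : is_lattice M ->
  a \is a Num.int -> b \is a Num.int -> M x -> M y -> M (a *: x + b *: y).
Proof.
move=> [B _ ->] /intrP[i ->] /intrP[j ->] [x' _ <-] [y' _ <-].
exists (i *: x' + j *: y') => //.
rewrite !scalemxAl -mulmxDl; congr (_ *m _).
by apply/matrixP => k l; rewrite !mxE rmorphD !rmorphM.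
Qed.

Lemma lattice_opp n (M : set 'rV[R]_n) x : is_lattice M -> M x -> M (- x).
Proof.
move=> hM Mx; rewrite -(addr0 (- x)) -(scale0r x) -scaleN1r.
by apply: lattice_comb; rewrite ?rpredN ?rpred1 ?rpred0.
Qed.

Lemma dual_lattice_comb n (M : set 'rV[R]_n) x y a b :
  a \is a Num.int -> b \is a Num.int ->
  dual_lattice M x -> dual_lattice M y -> dual_lattice M (a *: x + b *: y).
Proof.
by move=> ai bi Nx Ny z Mz; rewrite !pairingP rpredD// rpredM//; [exact: Nx|exact: Ny].
Qed.

Implicit Types (M P : set 'rV[R]_2) (v g r t x z : 'rV[R]_2).

(** A basis [(v, g)] of [M] together with the dual basis [(r, t)]. Coordinates
    of points are then values of the pairing, and [P] can be studied in lattice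
    coordinates adapted to [t] while staying in place. *)
Record lattice_frame M v g r t : Prop := LatticeFrame {
  frame_v : M v;
  frame_g : M g;
  frame_r : dual_lattice M r;
  frame_t : dual_lattice M t;
  frame_vr : pairing v r = 1;
  frame_vt : pairing v t = 0;
  frame_gr : pairing g r = 0;
  frame_gt : pairing g t = 1;
  frame_id : forall z, z = pairing z r *: v + pairing z t *: g }.

Lemma frame_pairing M v g r t a b : lattice_frame M v g r t ->
  pairing (a *: v + b *: g) r = a /\ pairing (a *: v + b *: g) t = b.
Proof.
move=> fr; rewrite !pairingP (frame_vr fr) (frame_vt fr) (frame_gr fr).
by rewrite (frame_gt fr); split; ring.
Qed.

Lemma frame_eq M v g r t x z : lattice_frame M v g r t ->
  pairing x r = pairing z r -> pairing x t = pairing z t -> x = z.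
Proof.
by move=> fr xr xt; rewrite (frame_id fr x) (frame_id fr z) xr xt.
Qed.

Lemma frame_lattice M v g r t z : is_lattice M -> lattice_frame M v g r t ->
  pairing z r \is a Num.int -> pairing z t \is a Num.int -> M z.
Proof.
move=> hM fr zr zt; rewrite (frame_id fr z).
by apply: lattice_comb => //; [exact: frame_v fr|exact: frame_g fr].
Qed.

Lemma frame_opp M v g r t : is_lattice M -> lattice_frame M v g r t ->
  lattice_frame M (- v) g (- r) t.
Proof.
move=> hM [Mv Mg Nr Nt vr vt gr gt id]; split; rewrite ?pairingP ?vr ?vt ?gr ?opprK ?oppr0//.
- exact: lattice_opp.
- by move=> x Mx; rewrite pairingP rpredN; exact: Nr.
- by move=> z; rewrite {1}(id z) pairingP scaleNr scalerN opprK.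
Qed.

Lemma exists_frame M : is_lattice M -> exists v g r t, lattice_frame M v g r t.
Proof.
move=> [B Bu ->]; pose D := (invmx B)^T.
have pBD i j : pairing (row i B) (row j D) = (i == j)%:R.
  transitivity ((B *m invmx B) i j); last by rewrite mulmxV// mxE.
  by rewrite pairingE mxE; apply: eq_bigr => k _; rewrite !mxE.
have MB i : lattice_of_basis B (row i B).
  exists (delta_mx 0 i) => //.
  by rewrite /= map_delta_mx -rowE.
have pzD z j : pairing z (row j D) = (z *m invmx B) 0 j.
  by rewrite pairingE mxE; apply: eq_bigr => k _; rewrite !mxE.
have ND j : dual_lattice (lattice_of_basis B) (row j D).
  move=> _ [z _ <-]; rewrite pzD mulmxK// mxE; exact: intr_int.
exists (row 0 B), (row 1 B), (row 0 D), (row 1 D); split=> //; rewrite ?pBD//.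
move=> z; rewrite !pzD -{1}(mulmxKV Bu z); apply/rowP => j.
have l1 : lift ord0 ord0 = 1 :> 'I_2 by exact/val_inj.
by rewrite mxE big_ord_recl big_ord1 l1 [in RHS]mxE [X in _ = X + _]mxE
  [X in _ = _ + X]mxE ![row _ _ _ _]mxE.
Qed.

(** The vector orthogonal to [t] in the coordinates of any frame completes [x]
    to a basis, because its determinant with [x] is [-<x, t>]. *)
Lemma frame_of_height M x t : is_lattice M -> M x -> dual_lattice M t ->
  pairing x t = -1 -> exists v r, lattice_frame M v (- x) r t.
Proof.
move=> hM Mx Nt xt; have [b [c [d [e fr]]]] := exists_frame hM.
have [Mb Mc Nd Ne bd be cd ce id] := fr.
pose x1 := pairing x d; pose x2 := pairing x e.
pose t1 := pairing b t; pose t2 := pairing c t.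
have xt' : x1 * t1 + x2 * t2 = -1 by rewrite -xt [in RHS](id x) !pairingP.
have tE z : pairing z t = pairing z d * t1 + pairing z e * t2.
  by rewrite {1}(id z) !pairingP.
exists (- t2 *: b + t1 *: c), (x2 *: d + - x1 *: e).
have rE z : pairing z (x2 *: d + - x1 *: e) = x2 * pairing z d - x1 * pairing z e.
  by rewrite !pairingP; ring.
have [ibd ibe] := frame_pairing (- t2) t1 fr.
split=> //.
- apply: lattice_comb => //; rewrite ?rpredN; exact: Nt.
- exact: lattice_opp.
- by apply: dual_lattice_comb => //; rewrite ?rpredN; [exact: Ne|exact: Nd].
- by rewrite rE ibd ibe; lra.
- by rewrite tE ibd ibe; ring.
- by rewrite rE !pairingP -/x1 -/x2; ring.
- by rewrite pairingP xt opprK.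
- move=> z; apply: (frame_eq fr); rewrite rE tE !pairingP ?(bd, be, cd, ce) -/x1 -/x2.
    transitivity (- (x1 * t1 + x2 * t2) * pairing z d); last by ring.
    by rewrite xt'; ring.
  transitivity (- (x1 * t1 + x2 * t2) * pairing z e); last by ring.
  by rewrite xt'; ring.
Qed.

(** If [z = X v] with [X > 1], then [v] is a nonzero lattice point of [P], hence
    has height [-1] under some functional that is at least [-1] on [P]; but
    that functional takes the value [-X] at [z]. *)
Lemma frame_slice M P v g r t z : is_lattice M -> reflexive_polytope M P ->
  lattice_frame M v g r t -> P z -> pairing z t = 0 ->
  -1 <= pairing z r <= 1.
Proof.
move=> hM hP; suff slice1 v' r' : lattice_frame M v' g r' t -> P z ->
    pairing z t = 0 -> pairing z r' <= 1.
  move=> fr Pz zt; rewrite (slice1 _ _ fr)// andbT.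
  by have := slice1 _ _ (frame_opp hM fr) Pz zt; rewrite pairingP; lra.
move=> fr Pz zt; set X := pairing z r'; rewrite leNgt; apply/negP => X1.
have zE : z = X *: v' by rewrite {1}(frame_id fr z) zt scale0r addr0.
have Xi : X * X^-1 = 1 by rewrite divff//; lra.
have Xi0 : 0 < X^-1 by rewrite invr_gt0; lra.
have Pv : P v'.
  have -> : v' = X^-1 *: z + (1 - X^-1) *: 0.
    by rewrite scaler0 addr0 zE scalerA mulrC Xi scale1r.
  apply: (polytope_conv (reflexive_polytopeW hP)) => //.
  - exact: ltW.
  - nra.
  - lra.
  - exact: (reflexive0 hP).
have v0 : v' != 0.
  apply/eqP => v0; have := frame_vr fr; rewrite v0 pairingP => /eqP.
  by rewrite eq_sym oner_eq0.
have [u [_ Pu vu]] := reflexive_height1 hP (frame_v fr) Pv v0.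
by have := Pu z Pz; rewrite zE pairingP vu; lra.
Qed.

End LatticeFrames.

(** * Counting vertices by level *)

Lemma card_uniq_seq (T : choiceType) (s : seq T) :
  uniq s -> [set` s] #= `I_(size s).
Proof.
move=> us; have -> : [set` s] = [set` [fset x in s]%fset].
  by apply/seteqP; split=> x /=; rewrite !inE.
by apply/card_eq_fsetP; rewrite card_fseq undup_id.
Qed.

Section LevelCount.
Context {R : realType} {T : eqType}.
Implicit Types (s : seq T) (h : T -> R) (v : T).

(** Every integer [k >= -1] satisfies [1 <= k + 2 [k = -1] + [k = 0]]; sum over
    [s]. *)
Lemma size_le_levels s h :
  (forall v, v \in s -> h v \is a Num.int /\ -1 <= h v) ->
  (size s)%:R <= \sum_(v <- s) h v + (count (fun v => h v == -1) s)%:R *+ 2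
                 + (count (fun v => h v == 0) s)%:R.
Proof.
elim: s => [|v s IH] hs; first by rewrite big_nil /= mul0rn !addr0.
have {}IH := IH (fun x xs => hs x (@mem_behead _ (v :: s) x xs)).
have [/intrP[k hk] hv] := hs v (mem_head v s).
rewrite big_cons /= !natrD -[(size s).+1]add1n natrD.
suff : 1 <= h v + (h v == -1)%:R *+ 2 + (h v == 0)%:R by lra.
move: hv; rewrite hk -[-1]/((-1)%:~R) -[0]/(0%:~R) !eqr_int ler_int => k1.
case: (eqVneq k (-1)) => [->|kN1] /=; first by lra.
case: (eqVneq k 0) => [->|k0] /=; first by lra.
have : (1 : int) <= k by lia.
by rewrite -(ler_int R); lra.
Qed.

(** Summing the same bound over the points other than [v] shows that the excess
    of [h v] over [1] is paid for by the slack in the total. *)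
Lemma level_le_slack s h v :
  (forall v, v \in s -> h v \is a Num.int /\ -1 <= h v) -> v \in s ->
  h v + (size s)%:R <=
    1 + \sum_(v <- s) h v + (count (fun v => h v == -1) s)%:R *+ 2
      + (count (fun v => h v == 0) s)%:R.
Proof.
move=> hs vs; have /= sv := perm_to_rem vs.
rewrite (perm_size sv) !(permP sv) (perm_big _ sv) big_cons /= !natrD.
have := @size_le_levels (rem v s) h (fun x xs => hs x (mem_rem xs)).
rewrite -[(size _).+1]addn1 natrD.
by have := ler0n R (h v == -1); have := ler0n R (h v == 0); lra.
Qed.

End LevelCount.

Section VertexCount.
Context {R : realType}.
Implicit Types (M P : set 'rV[R]_2) (u v t w p q r x y : 'rV[R]_2) (c : R).
Implicit Types (s : seq 'rV[R]_2).

(** Points at the same level of [u] are determined by their position along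
    [orthogonal_row u], so [q] would be a proper convex combination of [p] and
    [r]. *)
Lemma vertex_not_between P u p q r : u != 0 -> P p -> vertices P q -> P r ->
  pairing p u = pairing q u -> pairing r u = pairing q u ->
  pairing p (orthogonal_row u) < pairing q (orthogonal_row u) ->
  ~ pairing q (orthogonal_row u) < pairing r (orthogonal_row u).
Proof.
move=> u0 Pp vq Pr pq rq; set p' := pairing p _; set q' := pairing q _.
set r' := pairing r _ => pq' qr'.
have d0 : 0 < r' - p' by lra.
pose a := (r' - q') / (r' - p'); pose b := (q' - p') / (r' - p').
have a0 : 0 < a by rewrite divr_gt0//; lra.
have b0 : 0 < b by rewrite divr_gt0//; lra.
have ab : a + b = 1 by rewrite /a /b; field; lra.
have qE : q = a *: p + b *: r.
  apply: (orthogonal_row_inj u0); rewrite !pairingP.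
    by rewrite pq rq -mulrDl ab mul1r.
  by rewrite -/p' -/q' -/r' /a /b; field; lra.
have pqE := vertex_extreme vq Pp Pr a0 b0 ab qE.
by move: pq'; rewrite /p' pqE ltxx.
Qed.

Lemma three_vertices_not_collinear P u p q r : u != 0 ->
  vertices P p -> vertices P q -> vertices P r ->
  p != q -> q != r -> p != r ->
  pairing p u = pairing q u -> pairing r u = pairing q u -> False.
Proof.
move=> u0 vp vq vr pq qr pr pqu rqu.
have pru := etrans pqu (esym rqu).
have sep x y : x != y -> pairing x u = pairing y u ->
    pairing x (orthogonal_row u) != pairing y (orthogonal_row u).
  by move=> xy xyu; apply: contra xy => /eqP xyo; apply/eqP/(orthogonal_row_inj u0).
have [Pp _] := iffLR (vertexP _ _) vp; have [Pq _] := iffLR (vertexP _ _) vq.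
have [Pr _] := iffLR (vertexP _ _) vr.
have := vertex_not_between u0 Pp vq Pr pqu rqu.
have := vertex_not_between u0 Pr vq Pp rqu pqu.
have := vertex_not_between u0 Pp vr Pq pru (esym rqu).
have := vertex_not_between u0 Pq vr Pp (esym rqu) pru.
have := vertex_not_between u0 Pq vp Pr (esym pqu) (esym pru).
have := vertex_not_between u0 Pr vp Pq (esym pru) (esym pqu).
have := sep _ _ pq pqu; have := sep _ _ qr (esym rqu); have := sep _ _ pr pru.
case: (ltgtP (pairing p (orthogonal_row u)) (pairing q _)) => // _ ;
case: (ltgtP (pairing q (orthogonal_row u)) (pairing r _)) => // _ ;
case: (ltgtP (pairing p (orthogonal_row u)) (pairing r _)) => // _ ;
by intuition.
Qed.

Lemma vertices_on_line P u c s : u != 0 -> uniq s ->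
  (forall v, v \in s -> vertices P v) ->
  (count (fun v => pairing v u == c) s <= 2)%N.
Proof.
move=> u0 us sP; rewrite -size_filter.
have := filter_uniq (fun v => pairing v u == c) us.
have : forall v, v \in [seq v <- s | pairing v u == c] ->
    vertices P v /\ pairing v u = c.
  by move=> v; rewrite mem_filter => /andP[/eqP vc /sP].
case: [seq _ <- _ | _] => [|p [|q [|r l]]]// sl /= /and3P[].
rewrite !inE !negb_or => /and3P[pq pr _] /andP[qr _] _.
have [vp pc] := sl p ltac:(by rewrite !inE eqxx).
have [vq qc] := sl q ltac:(by rewrite !inE eqxx orbT).
have [vr rc] := sl r ltac:(by rewrite !inE eqxx !orbT).
by case: (three_vertices_not_collinear u0 vp vq vr pq qr pr); rewrite ?pc ?qc ?rc.
Qed.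

Lemma vertices_seq M P : lattice_polytope M P ->
  exists s, [/\ uniq s, forall v, v \in s <-> vertices P v
    & vertices P #= `I_(size s)].
Proof.
move=> /finite_vertices/finite_seqP[s vs]; exists (undup s).
have vE : vertices P = [set` undup s].
  by rewrite vs; apply/seteqP; split=> x /=; rewrite mem_undup.
split; first exact: undup_uniq.
  by move=> v; rewrite vE.
by rewrite vE; apply/card_uniq_seq/undup_uniq.
Qed.

(** For [w = 0] any nonzero dual lattice point of the polar dual will do; one
    is found by separating an arbitrary nonzero vector. *)
Lemma reflexive_dual_le0 M P w : reflexive_polytope M P ->
  exists t, [/\ dual_lattice M t, polar_dual P t, t != 0 & pairing w t <= 0].
Proof.
move=> hP; have nz (x t : 'rV[R]_2) : pairing x t < 0 -> t != 0.
  by apply: contraTneq => ->; rewrite pairingP ltxx.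
have [->|w0] := eqVneq w 0; last first.
  by have [t [Nt Pt wt]] := reflexive_dual_lt0 hP w0; exists t; split=> //;
    [exact: nz wt|exact: ltW].
have e0 : delta_mx 0 0 != 0 :> 'rV[R]_2.
  by apply/eqP => /rowP/(_ 0)/eqP; rewrite !mxE !eqxx oner_eq0.
have [t [Nt Pt wt]] := reflexive_dual_lt0 hP e0.
by exists t; split=> //; [exact: nz wt|rewrite pairingP].
Qed.

(** Choose [t] nonpositive on the sum of the vertices. With at most two
    vertices on each of the levels [-1] and [0], [size_le_levels] gives
    [size s <= 2 * 2 + 2]; in the case of equality there is no slack, so
    [level_le_slack] bounds all levels by [1]. *)
Lemma vertex_levels M P s : reflexive_polytope M P -> uniq s ->
  (forall v, v \in s <-> vertices P v) ->
  (size s <= 6)%N /\ (size s = 6%N -> exists t,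
    [/\ dual_lattice M t,
       count (fun v => pairing v t == -1) s = 2%N,
       count (fun v => pairing v t == 0) s = 2%N
     & forall v, v \in s -> -1 <= pairing v t <= 1]).
Proof.
move=> hP us sP; have hL := reflexive_polytopeW hP.
have [t [Nt Pt t0 wt]] := reflexive_dual_le0 (\sum_(v <- s) v) hP.
rewrite pairing_suml in wt.
have hs v : v \in s -> pairing v t \is a Num.int /\ -1 <= pairing v t.
  move=> /sP vv; split; first exact/Nt/(vertex_lattice hL).
  by apply: Pt; case/vertexP: vv.
have vs v : v \in s -> vertices P v by move/sP.
have c1 := @vertices_on_line P t (-1) s t0 us vs.
have c0 := @vertices_on_line P t 0 s t0 us vs.
have sz := size_le_levels hs.
have {}sz : (size s <= count (fun v => pairing v t == -1)%R s * 2
    + count (fun v => pairing v t == 0)%R s)%N.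
  by rewrite -(ler_nat R) natrD natrM mulr_natr; lra.
split=> [|s6]; first by lia.
have c1E : count (fun v => pairing v t == -1) s = 2%N by lia.
have c0E : count (fun v => pairing v t == 0) s = 2%N by lia.
exists t; split=> // v vs'; have [_ ->] := hs v vs' => /=.
have := level_le_slack hs vs'; rewrite c1E c0E s6; lra.
Qed.

Lemma int_pairing_le1 M x t : M x -> dual_lattice M t ->
  -1 <= pairing x t <= 1 ->
  [\/ pairing x t = -1, pairing x t = 0 | pairing x t = 1].
Proof.
move=> Mx /(_ x Mx)/intrP[k ->] /andP[k1 k2].
have {}k1 : -1 <= k by rewrite -(ler_int R).
have {}k2 : k <= 1 by rewrite -(ler_int R).
have [->|[->|->]] : k = -1 \/ k = 0 \/ k = 1 by lia.
- by constructor 1.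
- by constructor 2.
- by constructor 3.
Qed.

Lemma six_vertices_levels M P : reflexive_polytope M P -> vertices P #= `I_6 ->
  exists t p1 p2 e1 e2 q1 q2,
  [/\ dual_lattice M t,
      forall v, v \in [:: p1; p2; e1; e2; q1; q2] -> vertices P v,
      [/\ p1 != p2, e1 != e2 & q1 != q2],
      [/\ pairing p1 t = -1, pairing p2 t = -1 & pairing e1 t = 0]
    & [/\ pairing e2 t = 0, pairing q1 t = 1 & pairing q2 t = 1]].
Proof.
move=> hP v6; have hL := reflexive_polytopeW hP.
have [s [us sP vs]] := vertices_seq hL.
have s6 : size s = 6%N.
  apply/eqP; rewrite eqn_leq -!card_le_II.
  by rewrite -(card_le_eql vs) -(card_le_eqr vs) (card_le_eql v6) (card_le_eqr v6)
    card_lexx.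
have [_ /(_ s6)[t [Nt c1 c0 s1]]] := vertex_levels hP us sP.
pose sf c := [seq v <- s | pairing v t == c].
have sfP c v : v \in sf c -> vertices P v /\ pairing v t = c.
  by rewrite mem_filter => /andP[/eqP ? /sP].
have sfu c : uniq (sf c) by exact: filter_uniq.
have size1 : size (sf (-1)) = 2%N by rewrite size_filter.
have size0 : size (sf 0) = 2%N by rewrite size_filter.
have sizep : size (sf 1) = 2%N.
  have cE : count (fun v => pairing v t == 1) s =
      count (predC (fun v => (pairing v t == -1) || (pairing v t == 0))) s.
    apply: eq_in_count => v vs' /=.
    have /(int_pairing_le1 _ Nt) : -1 <= pairing v t <= 1 := s1 v vs'.
    case; first exact/(vertex_lattice hL)/sP.
    - by move=> ->; rewrite eqxx /=; apply/eqP; lra.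
    - by move=> ->; rewrite eqxx orbT /=; apply/eqP; lra.
    - by move=> ->; rewrite eqxx; apply/esym; rewrite negb_or;
        apply/andP; split; apply/eqP; lra.
  have cU : count (fun v => (pairing v t == -1) || (pairing v t == 0)) s = 4%N.
    have c10 : count (predI (fun v => pairing v t == -1)
        (fun v => pairing v t == 0)) s = 0%N.
      rewrite (@eq_count _ _ pred0) ?count_pred0// => v /=.
      by apply/negP => /andP[/eqP -> /eqP]; lra.
    rewrite (_ : count _ s = count (predU (fun v => pairing v t == -1)
      (fun v => pairing v t == 0)) s); last exact: eq_count.
    by rewrite -[LHS]addn0 -[X in (_ + X)%N = _]c10 count_predUI c1 c0.
  have := count_predC (fun v => (pairing v t == -1) || (pairing v t == 0)) s.
  by rewrite -cE cU s6 size_filter; lia.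
have := sfP (-1); have := sfP 0; have := sfP 1.
have := sfu (-1); have := sfu 0; have := sfu 1; move: size1 size0 sizep.
case: (sf (-1)) => [|p1 [|p2 []]]//; case: (sf 0) => [|e1 [|e2 []]]//.
case: (sf 1) => [|q1 [|q2 []]]// _ _ _ /=; rewrite !andbT !inE.
move=> q12 e12 p12 hq he hp; exists t, p1, p2, e1, e2, q1, q2.
have m1 x y : x \in [:: x; y] by rewrite mem_head.
have m2 x y : y \in [:: x; y] by rewrite !inE eqxx orbT.
have [vp1 p1E] := hp _ (m1 p1 p2); have [vp2 p2E] := hp _ (m2 p1 p2).
have [ve1 e1E] := he _ (m1 e1 e2); have [ve2 e2E] := he _ (m2 e1 e2).
have [vq1 q1E] := hq _ (m1 q1 q2); have [vq2 q2E] := hq _ (m2 q1 q2).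
by split=> // v; rewrite !inE; do 5![case/predU1P => [->//|]] => /eqP ->.
Qed.

End VertexCount.

(** * Reflexive polygons with six vertices *)

Section HexagonShape.
Context {R : realType}.
Implicit Types (M P : set 'rV[R]_2) (u v g r t x y z p q : 'rV[R]_2) (a b c : R).

(** The slice at level [0] runs at most from [-v] to [v], so its only nonzero
    lattice points are these two. *)
Lemma frame_vertex_slice M P v g r t e : is_lattice M -> reflexive_polytope M P ->
  lattice_frame M v g r t -> vertices P e -> pairing e t = 0 ->
  e = v \/ e = - v.
Proof.
move=> hM hP fr ve et; have Me := vertex_lattice (reflexive_polytopeW hP) ve.
have [Pe _] := iffLR (vertexP _ _) ve.
have eE : e = pairing e r *: v by rewrite {1}(frame_id fr e) et scale0r addr0.
have [er|er|er] := int_pairing_le1 Me (frame_r fr) (frame_slice hM hP fr Pe et).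
- by right; rewrite eE er scaleN1r.
- by have := vertex_neq0 hP isT ve; rewrite eE er scale0r eqxx.
- by left; rewrite eE er scale1r.
Qed.

(** The midpoint of [p] and [q] lies strictly between [-v] and [v], since
    neither end is the midpoint of two other points of [P]. *)
Lemma frame_vertex_sum M P v g r t p q : is_lattice M -> reflexive_polytope M P ->
  lattice_frame M v g r t -> vertices P v -> vertices P (- v) ->
  P p -> P q -> pairing p t = -1 -> pairing q t = 1 ->
  -2 < pairing p r + pairing q r < 2.
Proof.
move=> hM hP fr vv vNv Pp Pq pt qt; have hL := reflexive_polytopeW hP.
have Pm := polytope_midpoint hL Pp Pq; set m := 2^-1 *: _ in Pm.
have mt : pairing m t = 0 by rewrite !pairingP pt qt; lra.
have mr : pairing m r = 2^-1 * (pairing p r + pairing q r) by rewrite !pairingP.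
have /andP[m1 m2] := frame_slice hM hP fr Pm mt.
clearbody m; have mid w : vertices P w -> pairing w t = 0 -> pairing w r != pairing m r.
  move=> vw wt; apply/eqP => wm.
  have wE : w = 2^-1 *: p + 2^-1 *: q.
    by apply: (frame_eq fr); rewrite ?wt ?wm ?mr !pairingP ?pt ?qt; lra.
  have h2 : 0 < 2^-1 :> R by lra.
  have h1 : 2^-1 + 2^-1 = 1 :> R by lra.
  by have := vertex_extreme vw Pp Pq h2 h2 h1 wE => pw; move: wt; rewrite -pw pt; lra.
have := mid _ vv (frame_vt fr); have := mid _ vNv.
rewrite !pairingP (frame_vt fr) (frame_vr fr) oppr0 => /(_ erefl).
by rewrite mr => /eqP h1 /eqP h2; apply/andP; split; lra.
Qed.

(** Let [k], [l], [m] be the first coordinates of [p2], [q1], [q2] in a frame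
    with [g = - p1], normalised by [k > 0] and [l < m]. By
    [frame_vertex_sum] the sums [l] and [k + m] lie strictly between [-2] and
    [2], so [-1 <= l < m <= 1 - k], which forces [k = 1], [l = -1], [m = 0]. *)
Lemma six_vertices_frame M P : is_lattice M -> reflexive_polytope M P ->
  vertices P #= `I_6 -> exists v g r t, lattice_frame M v g r t /\
    forall x, x \in [:: v; - v; g; - g; v - g; g - v] -> vertices P x.
Proof.
move=> hM hP v6; have hL := reflexive_polytopeW hP.
have [t [p1 [p2 [e1 [e2 [q1 [q2 [Nt vP [p12 e12 q12]]]]]]]]] :=
  six_vertices_levels hP v6.
move=> [p1t p2t e1t] [e2t q1t q2t].
have [vp1 vp2 ve1] : [/\ vertices P p1, vertices P p2 & vertices P e1].
  by split; apply: vP; rewrite !inE eqxx ?orbT.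
have [ve2 vq1 vq2] : [/\ vertices P e2, vertices P q1 & vertices P q2].
  by split; apply: vP; rewrite !inE eqxx ?orbT.
have MP := vertex_lattice hL.
have Pv x : vertices P x -> P x by case/vertexP.
have [v0 [r0 fr0]] := frame_of_height hM (MP _ vp1) Nt p1t.
(* The sign of [v] is still free and can be used to order [p1] and [p2]. *)
wlog [v [r [fr p2r]]] : {v0 r0 fr0} / exists v r,
    lattice_frame M v (- p1) r t /\ 0 < pairing p2 r.
  apply; case: (ltgtP 0 (pairing p2 r0)) => [p2r|p2r|p2r].
  - by exists v0, r0.
  - by exists (- v0), (- r0); split; [exact: frame_opp|rewrite pairingP; lra].
  - case/eqP: p12; apply: (frame_eq fr0); last by rewrite p1t.
    by have := frame_gr fr0; rewrite pairingP -p2r; lra.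
have p1r : pairing p1 r = 0 by have := frame_gr fr; rewrite pairingP; lra.
wlog q12r : q1 q2 q12 vq1 vq2 q1t q2t {vP} / pairing q1 r < pairing q2 r.
  move=> H; case: (ltgtP (pairing q1 r) (pairing q2 r)) => [h|h|h].
  - exact: (H q1 q2).
  - by apply: (H q2 q1) => //; rewrite eq_sym.
  - by case/eqP: q12; apply: (frame_eq fr) => //; rewrite q1t.
have [vv vNv] : vertices P v /\ vertices P (- v).
  have [e1E|e1E] := frame_vertex_slice hM hP fr ve1 e1t;
  have [e2E|e2E] := frame_vertex_slice hM hP fr ve2 e2t;
    by subst e1 e2; rewrite ?eqxx in e12.
have /andP[h1 _] := frame_vertex_sum hM hP fr vv vNv (Pv _ vp1) (Pv _ vq1) p1t q1t.
have /andP[_ h2] := frame_vertex_sum hM hP fr vv vNv (Pv _ vp2) (Pv _ vq2) p2t q2t.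
have [/intrP[k kE] /intrP[l lE] /intrP[m mE]] :
  [/\ pairing p2 r \is a Num.int, pairing q1 r \is a Num.int
    & pairing q2 r \is a Num.int].
  by split; apply: (frame_r fr); exact: MP.
rewrite p1r add0r lE in h1; rewrite kE mE in h2.
rewrite kE in p2r; rewrite lE mE in q12r.
have {}p2r : 0 < k by rewrite -(ltr_int R).
have {}q12r : l < m by rewrite -(ltr_int R).
have {}h1 : -2 < l by rewrite -(ltr_int R).
have {}h2 : k + m < 2 by rewrite -(ltr_int R) rmorphD.
have [k1 [l1 m0]] : k = 1 /\ l = -1 /\ m = 0 by lia.
exists v, (- p1), r, t; split=> // x.
have p2E : p2 = v - - p1.
  by rewrite {1}(frame_id fr p2) p2t kE k1 scale1r scaleN1r.
have q1E : q1 = - p1 - v.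
  by rewrite {1}(frame_id fr q1) q1t lE l1 scale1r scaleN1r addrC.
have q2E : q2 = - p1.
  by rewrite {1}(frame_id fr q2) q2t mE m0 scale1r scale0r add0r.
by rewrite -p2E -q1E -q2E q2E opprK !inE => /or4P[|||/or3P[]] /eqP ->;
  rewrite -?q2E.
Qed.

(** No lattice point of [P] lies beyond the edge from [p] to [q]. A functional
    [w] exposing [p] has [pairing p w < pairing q w < 0], the second inequality
    because of [p - q]; a functional [z] exposing [q] has the two points
    exchanged. If [1 <= a] and [2 <= a + b], then [w] is smaller at
    [a *: p + b *: q] than at [p]; if [a <= 0], then [z] is smaller there than
    at [q]. *)
Lemma adjacent_vertices_le P p q a b : vertices P p -> vertices P q ->
  p != 0 -> q != 0 -> p != q -> P (p - q) -> P (q - p) ->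
  P (a *: p + b *: q) -> a \is a Num.int -> a + b < 2.
Proof.
move=> /vertexP[Pp [w pw]] /vertexP[Pq [z qz]] p0 q0 pq Ppq Pqp Ps /intrP[k ak].
have subN x y : y != 0 -> x - y != x.
  by apply: contra => /eqP/(congr1 (fun z => x - z)); rewrite subKr subrr => ->.
have w1 := pw _ Ppq (subN _ _ q0); have z1 := qz _ Pqp (subN _ _ p0).
have w2 : pairing p w < pairing q w by apply: pw; rewrite // eq_sym.
have z2 : pairing q z < pairing p z by exact: qz.
have w3 : pairing p w <= pairing (a *: p + b *: q) w.
  by have [->//|sp] := eqVneq (a *: p + b *: q) p; exact/ltW/pw.
have z3 : pairing q z <= pairing (a *: p + b *: q) z.
  by have [->//|sq] := eqVneq (a *: p + b *: q) q; exact/ltW/qz.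
rewrite !pairingP in w1 z1 w3 z3; rewrite ltNge; apply/negP => ab.
have [a1|a1] := lerP 1 a.
  have [b0|b0] := lerP 0 b; nra.
have a0 : a <= 0.
  rewrite ak in a1 *; have : k < 1 by rewrite -(ltr_int R).
  by rewrite -[0]/(0%:~R) ler_int; lia.
nra.
Qed.

End HexagonShape.

(** * Lattice isomorphisms *)

Section LatticeIso.
Context {R : realType}.

Lemma standard_latticeP n (x : 'rV[R]_n) :
  standard_lattice n x <-> forall i, x 0 i \is a Num.int.
Proof.
split=> [[z _ <-] i|xi]; first by rewrite mulmx1 mxE intr_int.
exists (map_mx Num.floor x) => //; rewrite mulmx1; apply/rowP => i.
by rewrite !mxE; apply/eqP; rewrite -intrEfloor xi.
Qed.

Lemma is_lattice_standard n : is_lattice (@standard_lattice R n).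
Proof. by exists 1%:M; first exact: unitmx1. Qed.

(** Lattice points mapped to the standard basis vectors are the rows of an
    inverse matrix. *)
Lemma linear_iso_matrix n (M : set 'rV[R]_n) (f : {linear 'rV[R]_n -> 'rV[R]_n}) :
  set_bij M (standard_lattice n) f ->
  exists2 A : 'M[R]_n, A \in unitmx & forall x, f x = x *m A.
Proof.
move=> [_ _ fS]; exists (lin1_mx f); last by move=> x; rewrite mul_rV_lin1.
have e_std i : standard_lattice n (delta_mx 0 i : 'rV[R]_n).
  by apply/standard_latticeP => j; rewrite mxE; case: (_ && _); rewrite ?rpred1 ?rpred0.
have pre i : exists m, f m = delta_mx 0 i by have [m _ fm] := fS _ (e_std i); exists m.
pose m i := projT1 (cid (pre i)); have fm i : f (m i) = delta_mx 0 i.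
  by rewrite /m; case: cid.
have : (\matrix_i m i) *m lin1_mx f = 1%:M.
  apply/row_matrixP => i; rewrite row_mul rowK mul_rV_lin1 fm.
  by apply/rowP => j; rewrite !mxE eqxx eq_sym.
by case/mulmx1_unit.
Qed.

Lemma frame_iso (M M' : set 'rV[R]_2) v g r t v' g' r' t' :
  is_lattice M -> is_lattice M' ->
  lattice_frame M v g r t -> lattice_frame M' v' g' r' t' ->
  exists f : {linear 'rV[R]_2 -> 'rV[R]_2}, set_bij M M' f /\
    forall x, f x = pairing x r *: v' + pairing x t *: g'.
Proof.
move=> hM hM' fr fr'.
pose f : {linear 'rV[R]_2 -> 'rV[R]_2} := mulmxr (r^T *m v' + t^T *m g').
have fE x : f x = pairing x r *: v' + pairing x t *: g'.
  rewrite /f /= mulmxDr !mulmxA [x *m r^T]mx11_scalar [x *m t^T]mx11_scalar.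
  by rewrite !mul_scalar_mx.
have fp x : pairing (f x) r' = pairing x r /\ pairing (f x) t' = pairing x t.
  by rewrite fE; exact: frame_pairing fr'.
exists f; split=> //; split.
- move=> x Mx /=; have [xr xt] := fp x; apply: (frame_lattice hM' fr').
    by rewrite xr; apply: (frame_r fr).
  by rewrite xt; apply: (frame_t fr).
- move=> x y _ _ fxy; have [xr xt] := fp x; have [yr yt] := fp y.
  by apply: (frame_eq fr); rewrite -?xr -?yr -?xt -?yt fxy.
- move=> y M'y; exists (pairing y r' *: v + pairing y t' *: g).
    apply: lattice_comb => //; [exact: (frame_r fr')|exact: (frame_t fr')|
      exact: (frame_v fr)|exact: (frame_g fr)].
  rewrite fE; have [-> ->] := frame_pairing (pairing y r') (pairing y t') fr.
  by rewrite -(frame_id fr').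
Qed.

Lemma standard_point2 (a b : int) : @standard_lattice R 2 (point2 a%:~R b%:~R).
Proof.
apply/standard_latticeP => -[[|[|//]] i]; rewrite mxE /=; exact: intr_int.
Qed.

Lemma standard_dual_point2 (a b : int) :
  dual_lattice (@standard_lattice R 2) (point2 a%:~R b%:~R).
Proof.
move=> x /standard_latticeP xi.
by rewrite (point2_eta x) pairing_point2 rpredD// rpredM// intr_int.
Qed.

(** The determinant [e] is its own inverse, so that [e] times the cofactors is
    the dual basis for both orientations. *)
Lemma standard_frame (a b c d e : int) : e = a * d - b * c -> e * e = 1 ->
  lattice_frame (@standard_lattice R 2)
    (point2 a%:~R b%:~R) (point2 c%:~R d%:~R)
    (point2 (e * d)%:~R (- (e * c))%:~R) (point2 (- (e * b))%:~R (e * a)%:~R).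
Proof.
move=> eE e2; have eR : (e%:~R * (a%:~R * d%:~R - b%:~R * c%:~R) = 1 :> R).
  by rewrite -!intrM -intrB -eE -intrM e2.
split; [exact: standard_point2|exact: standard_point2|exact: standard_dual_point2
  |exact: standard_dual_point2|..]; rewrite ?pairing_point2 ?mulrNz ?intrM ?intrM.
- by rewrite -[RHS]eR; ring.
- by ring.
- by ring.
- by rewrite -[RHS]eR; ring.
- move=> z; rewrite [in RHS](point2_eta z) !pairing_point2.
  rewrite ?mulrNz ?intrM; apply: row2P; rewrite !mxE /=.
    transitivity (z 0 0 * (e%:~R * (a%:~R * d%:~R - b%:~R * c%:~R))); last by ring.
    by rewrite eR mulr1.
  transitivity (z 0 1 * (e%:~R * (a%:~R * d%:~R - b%:~R * c%:~R))); last by ring.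
  by rewrite eR mulr1.
Qed.

Lemma convex_preimage m n (f : {linear 'rV[R]_m -> 'rV[R]_n}) C :
  @convex_set R 'rV[R]_n C -> @convex_set R 'rV[R]_m (f @^-1` C).
Proof.
move=> /convex_setP cC; apply/convex_setP => x y a b a0 b0 ab Cx Cy /=.
by rewrite linearD !linearZ; exact: cC.
Qed.

Lemma convex_image m n (f : {linear 'rV[R]_m -> 'rV[R]_n}) C :
  @convex_set R 'rV[R]_m C -> @convex_set R 'rV[R]_n (f @` C).
Proof.
move=> /convex_setP cC; apply/convex_setP => _ _ a b a0 b0 ab [x Cx <-] [y Cy <-].
by exists (a *: x + b *: y); rewrite ?linearD ?linearZ//; exact: cC.
Qed.

Lemma polytope_image m n M P A (f : {linear 'rV[R]_m -> 'rV[R]_n}) :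
  lattice_polytope M P ->
  (forall s, M s -> P s -> conv_hull A (f s)) -> A `<=` f @` P ->
  f @` P = conv_hull A.
Proof.
move=> hP fP Af; apply/seteqP; split; last first.
  apply: conv_hull_sub Af; apply: convex_image; case: hP => [S [_ _ ->]].
  exact: conv_hull_convex.
move=> _ [x + <-]; rewrite (polytope_hull hP).
have /convex_preimage cA := @conv_hull_convex R n A.
by move: x; apply: conv_hull_sub => [|x [Mx Px]]; [exact: cA|exact: fP].
Qed.

End LatticeIso.

(** * The standard hexagon *)

Section Hexagon.
Context {R : realType}.

(** The nonzero corners of the two unit squares, in cyclic order, so that each
    point is the sum of its two neighbours. *)
Definition hexagon_points : seq 'rV[R]_2 :=
  [seq point2 z.1%:~R z.2%:~R | z : int * int <-
    [:: (1, 1); (0, 1); (-1, 0); (-1, -1); (0, -1); (1, 0)]].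

Lemma point2_intr_inj :
  injective (fun z : int * int => point2 z.1%:~R z.2%:~R : 'rV[R]_2).
Proof.
move=> [a b] [c d] /= /rowP h; have := h 0; have := h 1; rewrite !mxE /=.
by move=> /intr_inj -> /intr_inj ->.
Qed.

Lemma hexagon_points_hull (x y : R) : -1 <= x <= 1 -> -1 <= y <= 1 ->
  -1 <= x - y <= 1 -> conv_hull [set` hexagon_points] (point2 x y).
Proof.
move=> /andP[x0 x1] /andP[y0 y1] /andP[xy0 xy1].
have hp (a b : int) : (a, b) \in [:: (1, 1); (0, 1); (-1, 0); (-1, -1); (0, -1); (1, 0)] ->
    conv_hull [set` hexagon_points] (point2 a%:~R b%:~R).
  move=> ab; apply: sub_conv_hull => /=.
  exact: (map_f (fun z : int * int => point2 z.1%:~R z.2%:~R) ab).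
have h0 : conv_hull [set` hexagon_points] 0.
  have -> : 0 = 2^-1 *: point2 1%:~R 0%:~R + 2^-1 *: point2 (-1)%:~R 0%:~R :> 'rV[R]_2.
    by apply: row2P; rewrite !mxE /=; ring.
  by apply: conv_hull2; [lra|lra|lra|exact: hp|exact: hp].
have cone (a b c d : int) k l : 0 <= k -> 0 <= l -> k + l <= 1 ->
    (a, b) \in [:: (1, 1); (0, 1); (-1, 0); (-1, -1); (0, -1); (1, 0)] ->
    (c, d) \in [:: (1, 1); (0, 1); (-1, 0); (-1, -1); (0, -1); (1, 0)] ->
    x = k * a%:~R + l * c%:~R -> y = k * b%:~R + l * d%:~R ->
    conv_hull [set` hexagon_points] (point2 x y).
  move=> k0 l0 kl ab cd xE yE.
  have -> : point2 x y = k *: point2 a%:~R b%:~R + l *: point2 c%:~R d%:~R.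
    by apply: row2P; rewrite !mxE.
  by apply: conv_hull_cone => //; exact: hp.
case: (lerP 0 x) => hx; case: (lerP 0 y) => hy; case: (lerP x y) => hxy; try lra.
- by apply: (@cone 1 1 0 1 x (y - x)) => //; (lra || ring).
- by apply: (@cone 1 1 1 0 y (x - y)) => //; (lra || ring).
- by apply: (@cone 1 0 0 (-1) x (- y)) => //; (lra || ring).
- by apply: (@cone (-1) 0 0 1 (- x) y) => //; (lra || ring).
- by apply: (@cone (-1) (-1) (-1) 0 (- y) (y - x)) => //; (lra || ring).
- by apply: (@cone (-1) (-1) 0 (-1) (- x) (x - y)) => //; (lra || ring).
Qed.

Lemma hexagonE : hexagon R = conv_hull [set` hexagon_points].
Proof.
apply/seteqP; split; apply: conv_hull_sub; try exact: conv_hull_convex.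
  move=> x [xsq|[y ysq <-]].
    have /andP[? ?] := xsq 0; have /andP[? ?] := xsq 1.
    by rewrite (point2_eta x); apply: hexagon_points_hull; apply/andP; split; lra.
  have /andP[? ?] := ysq 0; have /andP[? ?] := ysq 1.
  by rewrite (point2_eta (- y)); apply: hexagon_points_hull; rewrite !mxE;
    apply/andP; split; lra.
move=> _ /mapP[[a b] ab ->]; apply: sub_conv_hull => /=.
have sq (c d : int) : 0 <= c <= 1 -> 0 <= d <= 1 ->
    unit_square (point2 c%:~R d%:~R : 'rV[R]_2).
  by move=> c01 d01 [[|[|//]] i]; rewrite mxE /= ler0z lerz1.
have [[a01 b01]|[a01 b01]] :
    (0 <= a <= 1 /\ 0 <= b <= 1) \/ (0 <= - a <= 1 /\ 0 <= - b <= 1).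
  by move: ab; rewrite !inE !xpair_eqE; lia.
  by left; exact: sq.
right; exists (point2 (- a)%:~R (- b)%:~R); first exact: sq.
by apply: row2P; rewrite !mxE /= mulrNz opprK.
Qed.

Lemma hexagon_ge (c d : int) :
  all (fun z : int * int => -1 <= z.1 * c + z.2 * d)
    [:: (1, 1); (0, 1); (-1, 0); (-1, -1); (0, -1); (1, 0)] ->
  forall x, hexagon R x -> -1 <= x 0 0 * c%:~R + x 0 1 * d%:~R.
Proof.
move=> /allP cd x; rewrite hexagonE -[leRHS](pairing_point2 _ _ c%:~R d%:~R).
rewrite -point2_eta; apply: conv_hull_ge => _ /mapP[z /cd zcd ->].
by rewrite pairing_point2 -!intrM -intrD -[-1]/((-1)%:~R) ler_int.
Qed.

Lemma hexagon_vertices : [set` hexagon_points] `<=` vertices (hexagon R).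
Proof.
move=> v vh; apply/vertexP; split.
  by rewrite hexagonE; exact: sub_conv_hull.
have hx : forall x, hexagon R x -> [/\ -1 <= x 0 0 <= 1, -1 <= x 0 1 <= 1
    & -1 <= x 0 0 - x 0 1 <= 1].
  move=> x hx; have := hexagon_ge (c := 1) (d := 0) isT hx.
  have := hexagon_ge (c := -1) (d := 0) isT hx.
  have := hexagon_ge (c := 0) (d := 1) isT hx.
  have := hexagon_ge (c := 0) (d := -1) isT hx.
  have := hexagon_ge (c := 1) (d := -1) isT hx.
  have := hexagon_ge (c := -1) (d := 1) isT hx.
  by rewrite !mulr0z !mulr1z !mulrN1z; split; lra.
have expose (c d : R) : (forall x, hexagon R x ->
      x 0 0 * c + x 0 1 * d <= v 0 0 * c + v 0 1 * d ->
      x 0 0 = v 0 0 /\ x 0 1 = v 0 1) ->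
    exists u, forall x, hexagon R x -> x != v -> pairing v u < pairing x u.
  move=> cd; exists (point2 c d) => x /cd xv x_neq_v; rewrite !pairing2E !mxE /=.
  rewrite ltNge; apply: contra x_neq_v => /xv[x0 x1].
  by apply/eqP/row2P.
move: vh => /mapP[[a b] + vE]; rewrite !inE !xpair_eqE => ab.
have [v0 v1] : v 0 0 = a%:~R /\ v 0 1 = b%:~R by rewrite vE !mxE.
move: v0 v1; case/or4P: ab => [|||/or3P[]] /andP[/eqP -> /eqP ->];
  rewrite ?mulr0z ?mulr1z ?mulrN1z => v0 v1.
(* The sum of the inner normals of the two edges at a vertex exposes it. *)
- by apply: (expose (-1) (-1)) => x /hx[]; rewrite v0 v1; split; lra.
- by apply: (expose 1 (-2)) => x /hx[]; rewrite v0 v1; split; lra.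
- by apply: (expose 2 (-1)) => x /hx[]; rewrite v0 v1; split; lra.
- by apply: (expose 1 1) => x /hx[]; rewrite v0 v1; split; lra.
- by apply: (expose (-1) 2) => x /hx[]; rewrite v0 v1; split; lra.
- by apply: (expose (-2) 1) => x /hx[]; rewrite v0 v1; split; lra.
Qed.

Lemma card_hexagon_points : [set` hexagon_points] #= `I_6.
Proof.
by apply: (card_uniq_seq (s := hexagon_points)); rewrite map_inj_uniq//;
  exact: point2_intr_inj.
Qed.

Lemma hexagon_iso_six_vertices M (P : set 'rV[R]_2) :
  lattice_polytope_iso M P (standard_lattice 2) (hexagon R) ->
  `I_6 #<= vertices P.
Proof.
move=> [f [fM fP]]; have [A Au fE] := linear_iso_matrix fM.
rewrite -(card_le_eql card_hexagon_points).
apply: card_le_trans (subset_card_le hexagon_vertices) _.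
rewrite -fP; apply: card_le_trans (subset_card_le (vertices_image fE Au)) _.
exact: card_image_le.
Qed.

(** In the coordinates [X], [Y] of the frame, the six inequalities of the
    hexagon say that a lattice point of [P] is not beyond any of the six edges,
    which [adjacent_vertices_le] provides for each pair of consecutive
    vertices. *)
Lemma six_vertices_iso_hexagon M (P : set 'rV[R]_2) : is_lattice M ->
  reflexive_polytope M P -> vertices P #= `I_6 ->
  lattice_polytope_iso M P (standard_lattice 2) (hexagon R).
Proof.
move=> hM hP v6; have hL := reflexive_polytopeW hP.
have [v [g [r [t [fr vP]]]]] := six_vertices_frame hM hP v6.
have fr' := @standard_frame R 1 1 0 1 1 erefl erefl.
have [f [fM fE]] := frame_iso hM (@is_lattice_standard R 2) fr fr'.
exists f; split=> //; rewrite hexagonE.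
have {}fE x : f x = point2 (pairing x r) (pairing x r + pairing x t).
  by rewrite fE; apply: row2P; rewrite !mxE /=; ring.
have vtx x : x \in [:: v; - v; g; - g; v - g; g - v] ->
    [/\ vertices P x, P x & x != 0].
  move=> /vP vx; split=> //; first by case/vertexP: vx.
  exact: (vertex_neq0 hP).
have [[vv Pv v0] [vNv PNv Nv0] [vg Pg g0]] : [/\ [/\ vertices P v, P v & v != 0],
   [/\ vertices P (- v), P (- v) & - v != 0] & [/\ vertices P g, P g & g != 0]].
  by split; apply: vtx; rewrite !inE eqxx ?orbT.
have [[vNg PNg Ng0] [vvg Pvg vg0] [vgv Pgv gv0]] :
  [/\ [/\ vertices P (- g), P (- g) & - g != 0],
   [/\ vertices P (v - g), P (v - g) & v - g != 0] &
   [/\ vertices P (g - v), P (g - v) & g - v != 0]].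
  by split; apply: vtx; rewrite !inE eqxx ?orbT.
apply: (polytope_image hL) => [s Ms Ps|_ /mapP[[a b] ab ->]].
  (* [s] is rewritten in the basis formed by each pair of consecutive vertices. *)
  have ri := frame_r fr Ms; have ti := frame_t fr Ms.
  have sE := frame_id fr s; rewrite fE; move: sE ri ti.
  set X := pairing s r; set Y := pairing s t => sE Xi Yi.
  have neq p q : p - q != 0 -> p != q by rewrite subr_eq0.
  have XYi : X + Y \is a Num.int by rewrite rpredD.
  have h1 : X + Y < 2.
    apply: (@adjacent_vertices_le _ P v g) => //; [exact: neq|by rewrite -sE].
  have h2 : X + Y - X < 2.
    apply: (@adjacent_vertices_le _ P g (g - v)) => //.
    - by rewrite -subr_eq0 subKr.
    - by rewrite subKr.
    - by rewrite addrAC subrr add0r.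
    - by rewrite (_ : _ *: _ + _ *: _ = s)// [RHS]sE; apply/rowP => i; rewrite !mxE; ring.
  have h3 : Y - (X + Y) < 2.
    apply: (@adjacent_vertices_le _ P (g - v) (- v)) => //.
    - by rewrite -subr_eq0 opprK subrK.
    - by rewrite opprK subrK.
    - by rewrite opprB addrA addNr add0r.
    - by rewrite (_ : _ *: _ + _ *: _ = s)// [RHS]sE; apply/rowP => i; rewrite !mxE; ring.
  have h4 : - X - Y < 2.
    apply: (@adjacent_vertices_le _ P (- v) (- g)) => //.
    - by rewrite -subr_eq0 opprK addrC.
    - by rewrite opprK addrC.
    - by rewrite opprK addrC.
    - by rewrite !scaleNr !scalerN !opprK -sE.
    - by rewrite rpredN.
  have h5 : - (X + Y) + X < 2.
    apply: (@adjacent_vertices_le _ P (- g) (v - g)) => //.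
    - by rewrite -subr_eq0 opprB addrA addNr add0r.
    - by rewrite opprB addrA addNr add0r.
    - by rewrite opprK subrK.
    - by rewrite (_ : _ *: _ + _ *: _ = s)// [RHS]sE; apply/rowP => i; rewrite !mxE; ring.
    - by rewrite rpredN.
  have h6 : - Y + (X + Y) < 2.
    apply: (@adjacent_vertices_le _ P (v - g) v) => //.
    - by rewrite -subr_eq0 addrAC subrr add0r.
    - by rewrite addrAC subrr add0r.
    - by rewrite subKr.
    - by rewrite (_ : _ *: _ + _ *: _ = s)// [RHS]sE; apply/rowP => i; rewrite !mxE; ring.
    - by rewrite rpredN.
  have X1 : X <= 1 by apply: int_lt2_le1 => //; lra.
  have Y1 : Y <= 1 by apply: int_lt2_le1 => //; lra.
  have XY1 : X + Y <= 1 by apply: int_lt2_le1.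
  have NX1 : - X <= 1 by apply: int_lt2_le1; rewrite ?rpredN//; lra.
  have NY1 : - Y <= 1 by apply: int_lt2_le1; rewrite ?rpredN//; lra.
  have NXY1 : - (X + Y) <= 1 by apply: int_lt2_le1; rewrite ?rpredN//; lra.
  by apply: hexagon_points_hull; apply/andP; split; lra.
exists (a%:~R *: v + (b - a)%:~R *: g); last first.
  rewrite fE; have [-> ->] := frame_pairing a%:~R (b - a)%:~R fr.
  by rewrite intrB /= addrC subrK.
move: ab; rewrite !inE !xpair_eqE => ab.
case/or4P: ab => [|||/or3P[]] /andP[/eqP -> /eqP ->];
  rewrite ?subrr ?sub0r ?subr0 ?opprK ?mulrNz ?mulr0z ?mulr1z ?scaleN1r ?scale0r
    ?scale1r ?addr0 ?add0r//.
by rewrite addrC.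
Qed.

End Hexagon.

(** * Dimension, and diameters of sets of integers *)

Section Dimension.
Context {R : realType} {n : nat}.
Implicit Types (F : set 'rV[R]_n) (x y d w : 'rV[R]_n).

Lemma sub_affine_hull F : F `<=` affine_hull F.
Proof.
move=> x Fx; exists 1%N, (fun=> 1), (fun=> x); split=> //.
  by rewrite big_ord1.
by rewrite big_ord1 scale1r.
Qed.

(** The affine hull of at most one point has no direction. *)
Lemma has_dim_distinct F k : has_dim F k.+1 -> exists x y, [/\ F x, F y & x != y].
Proof.
move=> [x0 [U rU FU]]; apply: contrapT => Fxy.
have F1 x y : F x -> F y -> x = y.
  move=> Fx Fy; apply/eqP/negP => /negP xy.
  by apply: Fxy; exists x, y.
have aff1 p : F p -> forall x, affine_hull F x -> x = p.
  move=> Fp x [m [c [q [c1 Fq ->]]]].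
  rewrite (eq_bigr (fun i => c i *: p)) => [|i _]; last by rewrite (F1 _ _ (Fq i) Fp).
  by rewrite -scaler_suml c1 scale1r.
have [i Ui] : exists i, row i U != 0.
  apply/not_existsP => U0; suff : \rank U = 0%N by rewrite rU.
  apply/eqP; rewrite mxrank_eq0; apply/eqP/row_matrixP => i; rewrite row0.
  by apply/eqP/negP => /negP; exact: U0.
have Ax0 : affine_hull F x0 by rewrite FU; exists 0; rewrite ?addr0//=; exact: sub0mx.
have Ax1 : affine_hull F (x0 + row i U).
  by rewrite FU; exists (row i U) => //=; exact: row_sub.
have [p Fp] : exists p, F p.
  case: Ax0 => [[|m] [c [q [c1 Fq _]]]]; last by exists (q ord0).
  by move: c1; rewrite big_ord0 => /esym/eqP; rewrite oner_eq0.
have x0E := aff1 _ Fp _ Ax0; have x1E := aff1 _ Fp _ Ax1.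
by move: Ui; rewrite -(addKr x0 (row i U)) x1E x0E addNr eqxx.
Qed.

(** The direction space of the affine hull is proper, so some nonzero [w] is
    orthogonal to it. *)
Lemma has_dim_hyperplane F k : has_dim F k -> (k < n)%N ->
  exists w c, w != 0 /\ forall x, F x -> pairing x w = c.
Proof.
move=> [x0 [U rU FU]] kn.
have : kermx U^T != 0 by rewrite -mxrank_eq0 mxrank_ker mxrank_tr rU subn_eq0 -ltnNge.
move=> /rowV0Pn[w /sub_kermxP wU w0]; exists w, (pairing x0 w); split=> // x Fx.
have : affine_hull F x by exact: sub_affine_hull.
rewrite FU => -[u /= /submxP[c ->] <-].
by rewrite pairingDl pairing_mul wU pairing0r addr0.
Qed.

Lemma has_dim_segment F x d : F x -> F (x + d) -> d != 0 ->
  (forall y, F y -> exists a, y = x + a *: d) -> has_dim F 1.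
Proof.
move=> Fx Fxd d0 Fline; exists x, (genmx d); first by rewrite genmxE rank_rV d0.
apply/seteqP; split; last first.
  move=> _ [u /= + <-].
  rewrite genmxE => /sub_rVP[a ->].
  exists 2%N, (fun i : 'I_2 => if i == 0 then 1 - a else a),
    (fun i : 'I_2 => if i == 0 then x else x + d).
  split.
  - by rewrite big_ord_recl big_ord1 /= subrK.
  - by move=> i; case: ifP.
  - by rewrite big_ord_recl big_ord1 /= scalerBl scale1r scalerDr addrA subrK.
move=> y [m [c [q [c1 Fq yE]]]]; exists (y - x); last by rewrite addrC subrK.
have -> : y - x = \sum_(i < m) c i *: (q i - x).
  under eq_bigr do rewrite scalerBr.
  by rewrite sumrB -scaler_suml c1 scale1r yE.
rewrite /= genmxE; apply: summx_sub => i _; apply: scalemx_sub.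
have [a ->] := Fline _ (Fq i); rewrite addrAC subrr add0r.
exact: scalemx_sub.
Qed.

End Dimension.

(** A set of diameter [n] lies in the [n.+1] integers from its minimum on, and fills them
    all if it has [n.+1] elements. *)
Lemma card_int_diameter (K : set int) (n : nat) :
  (forall k l, K k -> K l -> l - k <= n%:Z) ->
  K #<= `I_n.+1 /\ (K #= `I_n.+1 -> exists2 k, K k & K (k + n%:Z)).
Proof.
move=> Kn; have [->|/set0P[k0 Kk0]] := eqVneq K set0.
  split; first exact: card_ge0.
  by move=> /card_eqPle[_]; rewrite card_le0 => /eqP/seteqP[/(_ 0%N isT)].
have exj : exists j : nat, (k0 - n%:Z + j%:Z) \in K.
  by exists n; rewrite subrK inE.
case: (ex_minnP exj) => j; rewrite inE => Kj jmin.
pose m := k0 - n%:Z + j%:Z.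
have KE k : K k -> exists2 i : nat, k = m + i%:Z & (i <= n)%N.
  move=> Kk; have := Kn _ _ Kk Kk0; have := Kn _ _ Kj Kk => h1 h2.
  have := jmin (absz (k - (k0 - n%:Z))%R); rewrite (_ : _ + _ = k); last by lia.
  rewrite inE => /(_ Kk) h3.
  by exists (absz (k - m)%R); rewrite /m in h1 *; lia.
have Ki i : (forall k, K k -> k = m + n%:Z -> (n < i)%N) -> (n <= i)%N -> K #<= `I_i.
  move=> Kmn ni.
  have : K `<=` (fun j : nat => m + j%:Z) @` `I_i.
    move=> k Kk; have [l kE ln] := KE _ Kk; exists l => //=.
    move: ln; rewrite leq_eqVlt => /predU1P[ln|]; last by move=> /leq_trans; apply.
    by rewrite ln; apply: (Kmn k) => //; rewrite kE ln.
  move=> /subset_card_le/card_le_trans; apply; exact: card_image_le.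
split; first by apply: Ki.
move=> Kn1; exists m => //; apply: contrapT => nK.
have : K #<= `I_n by apply: Ki => // k Kk kE; case: nK; rewrite -kE.
by rewrite (card_le_eql Kn1) card_le_II ltnn.
Qed.

(** * Facets and the standard triangle *)

Section Facets.
Context {R : realType}.
Implicit Types (M P F : set 'rV[R]_2) (u v g r t x y z p q s : 'rV[R]_2).

(** Two distinct points of a line that misses the origin are linearly
    independent. *)
Lemma height1_normal_uniq x y t u : x != y ->
  pairing x t = -1 -> pairing y t = -1 -> pairing x u = -1 -> pairing y u = -1 ->
  t = u.
Proof.
rewrite !pairing2E => xy xt yt xu yu.
pose D := x 0 0 * y 0 1 - x 0 1 * y 0 0.
have D0 : D != 0.
  apply: contra xy => /eqP D0; apply/eqP/row2P.
    have : D * u 0 1 = x 0 0 * (y 0 0 * u 0 0 + y 0 1 * u 0 1)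
      - y 0 0 * (x 0 0 * u 0 0 + x 0 1 * u 0 1) by rewrite /D; ring.
    by rewrite D0 xu yu; lra.
  have : D * u 0 0 = y 0 1 * (x 0 0 * u 0 0 + x 0 1 * u 0 1)
    - x 0 1 * (y 0 0 * u 0 0 + y 0 1 * u 0 1) by rewrite /D; ring.
  by rewrite D0 xu yu; lra.
apply: row2P; apply: (mulfI D0).
  transitivity (y 0 1 * (x 0 0 * t 0 0 + x 0 1 * t 0 1)
    - x 0 1 * (y 0 0 * t 0 0 + y 0 1 * t 0 1)); first by rewrite /D; ring.
  by rewrite xt yt -[in X in _ * X - _]xu -[in X in _ - _ * X]yu /D; ring.
transitivity (x 0 0 * (y 0 0 * t 0 0 + y 0 1 * t 0 1)
  - y 0 0 * (x 0 0 * t 0 0 + x 0 1 * t 0 1)); first by rewrite /D; ring.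
by rewrite xt yt -[in X in _ * X - _]yu -[in X in _ - _ * X]xu /D; ring.
Qed.

(** Scale the normal of the facet to [u1] with value [-1] on it, and let [x]
    and [y] be distinct points of the facet. The functional given by [x + y] is
    at least [-2] on the polar dual and equals [-2] at [u1], so it equals [-2]
    at some dual lattice point [t] of the polar dual. Then [t] has height [-1]
    at both [x] and [y], and coincides with [u1]. *)
Lemma facet_height M P F : reflexive_polytope M P -> facet P F ->
  exists t, [/\ dual_lattice M t, polar_dual P t
    & F = P `&` [set x | pairing x t = -1]].
Proof.
move=> hP [[u [c [Pc FE]]] dF]; have P0 := reflexive0 hP.
have [x [y [Fx Fy xy]]] := has_dim_distinct dF.
move: (Fx) (Fy); rewrite FE => -[Px xu] [Py yu]; rewrite /= in xu yu.
have c0 : c <= 0 by have := Pc _ P0; rewrite pairing0l.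
have {}c0 : c < 0.
  (* A face through the interior point [0] is all of [P], whose dimension is
     too large. *)
  rewrite lt_neqAle c0 andbT; apply/eqP => cE.
  have [u0|uN0] := eqVneq u 0; last first.
    have [s [_ Ps]] := reflexive_gt0 hP (w := - u) ltac:(by rewrite oppr_eq0).
    by have := Pc _ Ps; rewrite pairingNr cE; lra.
  have [w [d [w0 Fw]]] := has_dim_hyperplane dF (ltnSn 1).
  have {}Fw z : P z -> pairing z w = d.
    by move=> Pz; apply: Fw; rewrite FE; split=> //=; rewrite u0 pairing0r cE.
  have [s [_ Ps]] := reflexive_gt0 hP w0.
  by rewrite (Fw _ Ps) -(Fw _ P0) pairing0l ltxx.
have ci : c * c^-1 = 1 by rewrite divff// lt_eqF.
have ci0 : 0 < - c^-1 by rewrite oppr_gt0 invr_lt0.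
pose u1 := - c^-1 *: u.
have u1E z : pairing z u = c <-> pairing z u1 = -1.
  rewrite pairingZr; split=> [->|zu]; first by rewrite mulNr mulrC ci.
  by rewrite -[LHS]mul1r -ci; nra.
have Pu1 : polar_dual P u1.
  move=> z /Pc zc; rewrite pairingZr; nra.
have [_ _ _ hD] := hP.
have [t [Nt Pt [xt yt]]] : exists t, [/\ dual_lattice M t, polar_dual P t
    & pairing x t = -1 /\ pairing y t = -1].
  apply: contrapT => noT.
  suff : -2 < pairing u1 (x + y).
    by rewrite pairingC pairingDl (iffLR (u1E x) xu) (iffLR (u1E y) yu); lra.
  move: Pu1; rewrite {1}(polytope_hull hD); apply: conv_hull_gt => t [Nt Pt].
  rewrite pairingC pairingDl ltNge; apply/negP => xyt; apply: noT; exists t.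
  by have := Pt _ Px; have := Pt _ Py; split=> //; split; lra.
have tE : t = u1.
  by apply: (height1_normal_uniq xy) => //; [exact/u1E|exact/u1E].
exists t; split=> //; rewrite tE.
by apply/seteqP; split=> z [Pz] /= /u1E.
Qed.

(** The segment from [p] to [s] crosses level [0], where the polytope is
    confined to [[-v, v]]. *)
Lemma facet_slice M P v g r t p s : is_lattice M -> reflexive_polytope M P ->
  lattice_frame M v g r t -> P p -> pairing p t = -1 -> P s -> 0 < pairing s t ->
  - (pairing s t + 1) <= pairing s t * pairing p r + pairing s r
    <= pairing s t + 1.
Proof.
move=> hM hP fr Pp pt Ps; set h := pairing s t => h0.
have hi : (h + 1) * (h + 1)^-1 = 1 by rewrite divff//; lra.
have hi0 : 0 < (h + 1)^-1 by rewrite invr_gt0; lra.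
pose z := (h / (h + 1)) *: p + (h + 1)^-1 *: s.
have Pz : P z.
  apply: (polytope_conv (reflexive_polytopeW hP)) => //.
  - by rewrite mulr_ge0//; lra.
  - exact: ltW.
  - by rewrite -[X in _ + X]mul1r -mulrDl hi.
have zt : pairing z t = 0.
  by rewrite pairingDl !pairingZl pt -/h; ring.
have zr : h * pairing p r + pairing s r = (h + 1) * pairing z r.
  rewrite pairingDl !pairingZl mulrDr !mulrA hi mul1r; congr (_ + _).
  by rewrite [(h + 1) * h]mulrC -[h * _ * _]mulrA hi mulr1.
have /andP[z1 z2] := frame_slice hM hP fr Pz zt.
by rewrite zr; apply/andP; split; nra.
Qed.

(** For [s] at level [h >= 1], [facet_slice] at [p] and at [q] bounds [h] times
    the difference by [2 * (h + 1)], which is at most [4 * h]. *)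
Lemma facet_diameter M P v g r t p q : is_lattice M -> reflexive_polytope M P ->
  lattice_frame M v g r t -> P p -> pairing p t = -1 -> P q -> pairing q t = -1 ->
  pairing q r - pairing p r <= 4.
Proof.
move=> hM hP fr Pp pt Pq qt.
have t0 : t != 0.
  by apply/eqP => t0; move: pt; rewrite t0 pairing0r => /eqP; rewrite eq_sym oppr_eq0 oner_eq0.
have [s [Ms Ps st]] := reflexive_gt0 hP t0.
have /andP[_ hq] := facet_slice hM hP fr Pq qt Ps st.
have /andP[hp _] := facet_slice hM hP fr Pp pt Ps st.
have := int_gt0_ge1 (frame_t fr Ms) st; nra.
Qed.

(** A shear along the levels of [t]; it moves the zero of the other coordinate. *)
Lemma frame_shift M v g r t (k : int) : is_lattice M -> lattice_frame M v g r t ->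
  lattice_frame M v (g - k%:~R *: v) (r + k%:~R *: t) t.
Proof.
move=> hM [Mv Mg Nr Nt vr vt gr gt id].
split; rewrite ?pairingP ?vr ?vt ?gr ?gt//; try ring.
- rewrite -[g]scale1r -scaleNr; apply: lattice_comb => //.
  by rewrite rpredN intr_int.
- rewrite -[r]scale1r; apply: dual_lattice_comb => //; exact: intr_int.
- move=> z; rewrite {1}(id z) !pairingP.
  by apply/rowP => i; rewrite !mxE; ring.
Qed.

(** In a frame of the facet its lattice points correspond to a set of integers
    of diameter at most [4]; a facet with five of them starts at some point
    [- g] and reaches [4 *: v - g]. *)
Lemma facet_lattice_points M P F : is_lattice M -> reflexive_polytope M P ->
  facet P F -> F `&` M #<= `I_5 /\
  (F `&` M #= `I_5 -> exists v g r t,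
    [/\ lattice_frame M v g r t, polar_dual P t, P (- g) & P (4 *: v - g)]).
Proof.
move=> hM hP hF; have [t [Nt Pt FE]] := facet_height hP hF.
have [FM0|/set0P[a [Fa Ma]]] := eqVneq (F `&` M) set0.
  rewrite FM0; split; first exact: card_ge0.
  by move=> /card_eqPle[_]; rewrite card_le0 => /eqP/seteqP[/(_ 0%N isT)].
have [Pa at1] : P a /\ pairing a t = -1 by move: Fa; rewrite FE => -[].
have [v [r fr]] := frame_of_height hM Ma Nt at1.
pose point (k : int) := k%:~R *: v + a.
pose K := [set k : int | P (point k)].
have pt k : pairing (point k) r = k%:~R /\ pairing (point k) t = -1.
  have := frame_pairing k%:~R (-1) fr.
  by rewrite scaleN1r opprK.
have FME : F `&` M = point @` K.
  apply/seteqP; split=> [z [Fz Mz]|_ [k Kk <-]].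
    move: (Fz); rewrite FE => -[Pz /= zt].
    have /intrP[k kE] := frame_r fr Mz; have [kr kt] := pt k.
    have kz : point k = z by apply: (frame_eq fr); rewrite ?kr ?kt ?kE ?zt.
    by exists k; rewrite /K /= ?kz.
  have [kr kt] := pt k; split; first by rewrite FE.
  by apply: (frame_lattice hM fr); rewrite ?kr ?kt ?rpredN ?rpred1 ?intr_int.
have point_inj : {in K &, injective point}.
  move=> k l _ _ kl; have [kr _] := pt k; have [lr _] := pt l.
  by apply/eqP; rewrite -(eqr_int R) -kr -lr kl.
have [K5 K5E] := @card_int_diameter K 4 ltac:(
  move=> k l Kk Kl; have [kr kt] := pt k; have [lr lt] := pt l;
  have := facet_diameter hM hP fr Kk kt Kl lt;
  by rewrite kr lr -intrB -[4]/(4%:~R) ler_int).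
have KF : K #= F `&` M by rewrite FME card_eq_sym; exact: inj_card_eq.
split; first by rewrite -(card_le_eql KF).
rewrite -(card_eql KF) => /K5E[k Kk K4].
exists v, (- a - k%:~R *: v), (r + k%:~R *: t), t.
have shift : - (- a - k%:~R *: v) = point k by rewrite opprB opprK.
split; [exact: frame_shift|exact: Pt|by rewrite shift|].
rewrite shift (_ : _ + _ = point (k + 4))//.
by rewrite /point intrD addrA -scalerDl [4 + _]addrC.
Qed.

End Facets.

Section Triangle.
Context {R : realType}.
Implicit Types (M P F : set 'rV[R]_2) (v g r t x y z p q s : 'rV[R]_2).

Lemma triangle_hull (x y : R) : x <= 1 -> y <= 1 -> -1 <= 2 * x + y ->
  triangle R (point2 x y).
Proof.
move=> x1 y1 xy.
have -> : point2 x y = ((1 - x) / 2) *: point2 (-1) 1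
    + ((2 * x + y + 1) / 4) *: point2 1 1 + ((1 - y) / 4) *: point2 1 (-3).
  by apply: row2P; rewrite !mxE /=; field.
apply: conv_hull3; try lra; apply: sub_conv_hull; [by left; left|by left; right|by right].
Qed.

Lemma triangle_le1 x : triangle R x -> x 0 0 <= 1 /\ -3 <= x 0 1.
Proof.
move=> tx; split.
  rewrite (_ : x 0 0 = pairing x (point2 1 0)); last by rewrite pairing2E !mxE /=; ring.
  apply: conv_hull_le tx => _ [[->|->]|->]; rewrite pairing_point2; lra.
rewrite (_ : x 0 1 = pairing x (point2 0 1)); last by rewrite pairing2E !mxE /=; ring.
apply: conv_hull_ge tx => _ [[->|->]|->]; rewrite pairing_point2; lra.
Qed.

(** With [- g] and [4 *: v - g] at positions [0] and [4] of level [-1], the two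
    bounds of [facet_slice] leave position [-2] at level [1] as the only
    lattice point [s] of positive level. The other lattice points of [P] are
    at positions [0] to [4] of level [-1] and [-1] to [1] of level [0]. *)
Lemma wide_facet_iso_triangle M P v g r t : is_lattice M -> reflexive_polytope M P ->
  lattice_frame M v g r t -> polar_dual P t -> P (- g) -> P (4 *: v - g) ->
  lattice_polytope_iso M P (standard_lattice 2) (triangle R).
Proof.
move=> hM hP fr Pt Pp Pq; have hL := reflexive_polytopeW hP.
have [pr ptE] : pairing (- g) r = 0 /\ pairing (- g) t = -1.
  by rewrite !pairingP (frame_gr fr) (frame_gt fr) oppr0.
have [qr qt] := frame_pairing 4 (-1) fr; rewrite scaleN1r in qr qt.
(* [standard_frame] at these entries sends the facet to the right-hand side of
   the triangle, with [- g] at the top. *)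
have fr' := @standard_frame R 0 (-1) (-1) (-1) (-1) erefl erefl.
have [f [fM fE]] := frame_iso hM (@is_lattice_standard R 2) fr fr'.
have {}fE x : f x = point2 (- pairing x t) (- pairing x r - pairing x t).
  by rewrite fE; apply: row2P; rewrite !mxE /=; ring.
have t0 : t != 0.
  by apply/eqP => t0; have /eqP := frame_gt fr; rewrite t0 pairing0r eq_sym oner_eq0.
have apex s : M s -> P s -> 0 < pairing s t -> pairing s t = 1 /\ pairing s r = -2.
  move=> Ms Ps st; have := int_gt0_ge1 (frame_t fr Ms) st.
  have /andP[h1 h2] := facet_slice hM hP fr Pp ptE Ps st.
  have /andP[h3 h4] := facet_slice hM hP fr Pq qt Ps st.
  rewrite pr in h1 h2; rewrite qr in h3 h4.
  by move=> st1; split; lra.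
exists f; split=> //; apply: (polytope_image hL) => [s Ms Ps|].
  have sYge := Pt _ Ps; rewrite fE.
  case: (ltgtP (pairing s t) 0) => st.
  - have sY : pairing s t = -1.
      have := @int_gt0_ge1 _ (- pairing s t) ltac:(rewrite rpredN; exact: (frame_t fr)).
      by lra.
    have := facet_diameter hM hP fr Pp ptE Ps sY.
    have := facet_diameter hM hP fr Ps sY Pq qt.
    by rewrite pr qr sY => h1 h2; apply: triangle_hull; lra.
  - by have [-> ->] := apex _ Ms Ps st; apply: triangle_hull; lra.
  - have /andP[h1 h2] := frame_slice hM hP fr Ps st.
    by rewrite st; apply: triangle_hull; lra.
move=> _ [[->|->]|->].
- have [s [Ms Ps st]] := reflexive_gt0 hP t0; exists s => //.
  by have [s1 s2] := apex _ Ms Ps st; rewrite fE s1 s2; congr point2; lra.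
- by exists (- g) => //; rewrite fE pr ptE; congr point2; lra.
- by exists (4 *: v - g) => //; rewrite fE qr qt; congr point2; lra.
Qed.

(** The preimage of the side at first coordinate [1] contains the five lattice
    points [p + k d]; there are no others by [facet_lattice_points]. *)
Lemma triangle_iso_wide_facet M P : is_lattice M -> reflexive_polytope M P ->
  lattice_polytope_iso M P (standard_lattice 2) (triangle R) ->
  exists F, facet P F /\ F `&` M #= `I_5.
Proof.
move=> hM hP [f [fM fP]]; have [A Au fE] := linear_iso_matrix fM.
have f_inj : injective f.
  by move=> x y; rewrite !fE => /(congr1 (mulmx^~ (invmx A))); rewrite !mulmxK.
have [_ _ fS] := fM.
have [p Mp fp] := fS _ (standard_point2 1 1).
have [d Md fd] := fS _ (standard_point2 0 (-1)).
have pd a : f (p + a *: d) = point2 1 (1 - a).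
  by rewrite linearD linearZ fp fd; apply: row2P; rewrite !mxE /=; ring.
have triP x : triangle R (f x) -> P x.
  by rewrite -fP => -[z Pz /f_inj <-].
have Ppd a : 0 <= a <= 4 -> P (p + a *: d).
  by move=> /andP[a0 a4]; apply: triP; rewrite pd; apply: triangle_hull; lra.
pose u := point2 (-1) 0 *m A^T.
have uE x : pairing x u = - (f x) 0 0.
  by rewrite -pairing_mul -fE pairing2E !mxE /=; ring.
have fPx x : P x -> triangle R (f x) by move=> Px; rewrite -fP; exists x.
pose F := P `&` [set x | pairing x u = -1].
have Fpd a : 0 <= a <= 4 -> F (p + a *: d).
  by move=> /Ppd Pa; split=> //=; rewrite uE pd mxE.
have hF : facet P F.
  split.
    exists u, (-1); split=> // x /fPx/triangle_le1[x1 _]; rewrite uE; lra.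
  apply: (@has_dim_segment _ _ _ p d).
  - by have := Fpd 0; rewrite scale0r addr0; apply; lra.
  - by have := Fpd 1; rewrite scale1r; apply; lra.
  - apply/eqP => d0; move: fd; rewrite d0 linear0 => /rowP/(_ 1).
    by rewrite !mxE /= mulrN1z => /eqP; rewrite eq_sym oppr_eq0 oner_eq0.
  - move=> y [Py /= yu]; exists (1 - f y 0 1); apply: f_inj; rewrite pd.
    by apply: row2P; rewrite !mxE /=; [rewrite uE in yu; lra|lra].
exists F; split=> //.
have [F5 _] := facet_lattice_points hM hP hF.
suff F5' : `I_5 #<= F `&` M by apply/card_eqPle.
have pd_inj : {in `I_5 &, injective (fun k : nat => p + k%:R *: d)}.
  move=> k l _ _ /(congr1 f); rewrite !pd => /rowP/(_ 1); rewrite !mxE /= => kl.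
  by apply/eqP; rewrite -(eqr_nat R); apply/eqP; lra.
rewrite -(card_le_eql (inj_card_eq pd_inj)); apply: subset_card_le => _ [k /= k5 <-].
split; first by apply: Fpd; rewrite ler0n ler_nat -ltnS.
by rewrite -[p]scale1r; apply: lattice_comb => //; rewrite ?rpred1// natr_int.
Qed.

End Triangle.

(** * Reflexive polygons with the most vertices and the longest facets *)

Theorem corollary3p3 (R : realType) (M P : set 'rV[R]_2)
    (hM : is_lattice M) (hP : reflexive_polytope M P) :
  (vertices P #<= `I_6 /\
   (vertices P #= `I_6 <->
    lattice_polytope_iso M P (standard_lattice 2) (hexagon R))) /\
  ((forall F : set 'rV[R]_2, facet P F -> F `&` M #<= `I_5) /\
   ((exists F : set 'rV[R]_2, facet P F /\ F `&` M #= `I_5) <->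
    lattice_polytope_iso M P (standard_lattice 2) (triangle R))).
Proof.
have v6 : vertices P #<= `I_6.
  have [s [us sP vs]] := vertices_seq (reflexive_polytopeW hP).
  by rewrite (card_le_eql vs) card_le_II; have [] := vertex_levels hP us sP.
split; split=> //.
- split=> [|/hexagon_iso_six_vertices v6']; first exact: six_vertices_iso_hexagon.
  exact/card_eqPle.
- by move=> F /(facet_lattice_points hM hP)[].
- split=> [[F [hF F5]]|]; last exact: triangle_iso_wide_facet.
  have [_ /(_ F5)[v [g [r [t [fr Pt Pp Pq]]]]]] := facet_lattice_points hM hP hF.
  exact: wide_facet_iso_triangle fr Pt Pp Pq.
Qed.
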